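(* Let $p>3$ be a prime. Then $$4\sum_{k=1}^{p-1}\frac{1}{k^4\binom{2k}{k}}-3\sum_{k=1}^{p-1}\frac{H_{k-1}(2)}{k^2\binom{2k}{k}}\equiv \frac{3}{p^3}H_{p-1}(1)-\frac{6}{5}\,p\,B_{p-5}\pmod{p^2}.$$
   Context: For integers $n\ge 0$ and $a\ge 1$, $H_n(a)=\sum_{k=1}^n \frac{1}{k^a}$ (empty sum is $0$). $B_m\in\mathbb{Q}$ are the Bernoulli numbers defined by $\frac{t}{e^t-1}=\sum_{m\ge 0}B_m\frac{t^m}{m!}$. For rational numbers $x,y$ (whose denominators may be divisible by $p$), $x\equiv y\pmod{p^r}$ means that $x-y$ has $p$-adic valuation at least $r$. *)

(* Defs.v *)
From mathcomp Require Import all_boot all_order all_algebra.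

Set Implicit Arguments.
Unset Strict Implicit.
Unset Printing Implicit Defensive.

Import Order.TTheory GRing.Theory Num.Theory.
Local Open Scope ring_scope.

Definition harmonic (n a : nat) : rat := \sum_(1 <= k < n.+1) (k%:R ^+ a)^-1.

(* A formal power series over rat is given by its coefficient function
   nat -> rat. *)

Definition fps_mul (f g : nat -> rat) (n : nat) : rat :=
  \sum_(i < n.+1) f i * g (n - i)%N.

Fixpoint fps_inv_seq (f : nat -> rat) (n : nat) : seq rat :=
  if n is m.+1 then
    let s := fps_inv_seq f m in
    rcons s ((f 0%N)^-1 * ((m == 0%N)%:R - \sum_(i < m) s`_i * f (m - i)%N))
  else [::].

(* The multiplicative inverse of f when f 0 != 0: see fps_mulVf. *)
Definition fps_inv (f : nat -> rat) (n : nat) : rat := (fps_inv_seq f n.+1)`_n.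

(* Since e^t - 1 has no constant term, t / (e^t - 1) is read as the inverse of
   (e^t - 1) / t = \sum_n t^n / (n+1)!, and B_m is m! times its m-th coefficient
   (so B_1 = -1/2). The generating function identity and the fact that it
   determines the B_m are bernoulli_gf and bernoulli_gf_uniq. *)
Definition bernoulli (m : nat) : rat :=
  m`!%:R * fps_inv (fun n => (n.+1`!%:R)^-1) m.

(* For x != 0; the junk value at 0 is not used in rat_eqmod. *)
Definition padic_val (p : nat) (x : rat) : int :=
  (logn p `|numq x|%N)%:Z - (logn p `|denq x|%N)%:Z.

(* x and y need not be p-integral; the case x = y stands for v_p(0) = +oo. *)
Definition rat_eqmod (p r : nat) (x y : rat) : Prop :=
  x = y \/ (r%:Z <= padic_val p (x - y))%R.

Lemma size_fps_inv_seq f n : size (fps_inv_seq f n) = n.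
Proof. by elim: n => //= n IH; rewrite size_rcons IH. Qed.

Lemma nth_fps_inv_seq f n i : (i < n)%N -> (fps_inv_seq f n)`_i = fps_inv f i.
Proof.
elim: n => // n IH; rewrite ltnS leq_eqVlt => /orP [/eqP -> //|lt_in].
by rewrite /= nth_rcons size_fps_inv_seq lt_in IH.
Qed.

Lemma fps_invE f n :
  fps_inv f n =
  (f 0%N)^-1 * ((n == 0%N)%:R - \sum_(i < n) fps_inv f i * f (n - i)%N).
Proof.
rewrite {1}/fps_inv /= nth_rcons size_fps_inv_seq ltnn eqxx.
by congr (_ * (_ - _)); apply: eq_bigr => i _; rewrite nth_fps_inv_seq.
Qed.

Lemma fps_mulVf f n : f 0%N != 0 -> fps_mul (fps_inv f) f n = (n == 0%N)%:R.
Proof.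
move=> f0; rewrite /fps_mul big_ord_recr /= subnn [fps_inv f n]fps_invE.
by rewrite mulrC mulrA divff // mul1r addrC subrK.
Qed.

Lemma bernoulli_gf n :
  fps_mul (fun m => bernoulli m / m`!%:R)
          (fun m => (m`!%:R)^-1 - (m == 0%N)%:R) n = (n == 1%N)%:R.
Proof.
have fact_neq0 m : (m`!%:R : rat) != 0 by rewrite pnatr_eq0 -lt0n fact_gt0.
rewrite /fps_mul big_ord_recr /= subnn fact0 invr1 subrr mulr0 addr0.
case: n => [|n]; first by rewrite big_ord0.
rewrite eqSS -(@fps_mulVf (fun m => (m.+1`!%:R)^-1)) ?invr_eq0 ?fact_neq0 //.
apply: eq_bigr => i _.
by rewrite /bernoulli mulrC mulrAC mulfV // mul1r mulrC subSn ?subr0 // -ltnS.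
Qed.

Lemma bernoulli_gf_uniq (b : nat -> rat) :
  (forall n, fps_mul (fun m => b m / m`!%:R)
                     (fun m => (m`!%:R)^-1 - (m == 0%N)%:R) n = (n == 1%N)%:R) ->
  b =1 bernoulli.
Proof.
have fact_neq0 m : (m`!%:R : rat) != 0 by rewrite pnatr_eq0 -lt0n fact_gt0.
move=> gf n; have [m] := ubnP n; elim: m n => // m IH n; rewrite ltnS => le_nm.
have := gf n.+1; rewrite -(bernoulli_gf n.+1) /fps_mul.
rewrite big_ord_recr [in RHS]big_ord_recr /= subnn subrr !mulr0 !addr0.
rewrite big_ord_recr [in RHS]big_ord_recr /= subSnn /= subr0 invr1 !mulr1.
under eq_bigr => i _ do rewrite (IH i (leq_trans (ltn_ord i) le_nm)).
by move/addrI/(mulIf (invr_neq0 (fact_neq0 n))).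
Qed.

(* Main.v *)
Require Import Defs.
From HB Require Import structures.
From mathcomp Require Import all_boot all_order all_algebra.
From mathcomp Require Import ring zify.
Import Order.TTheory GRing.Theory Num.Theory.
Set Implicit Arguments.
Unset Strict Implicit.
Unset Printing Implicit Defensive.

Local Open Scope ring_scope.

(** The combination on the left comes from Leshchiner's acceleration of zeta(4),
    7/4 zeta(4) = 4 sum 1/(k^4 C(2k,k)) - 3 sum H_{k-1}(2)/(k^2 C(2k,k)), which
    has an exact truncation (leshchiner_finite): summed up to k = n, the right-hand
    side is the partial sum of 2 sum (-1)^(k-1)/k^4 = 7/4 zeta(4) plus the tail

      sum_{k <= n} (-1)^(n+k) H_{k-1}(2) / (k^2 C(n,k) C(n+k,k)).

    For n = p-1 the denominators C(2k,k), which p may divide, have disappeared,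
    and (-1)^k C(p-1,k) C(p-1+k,k) = p/(p+k) prod_{j<=k} (1 - p^2/j^2), so that
    the tail is 1/p times an expression in nested harmonic sums of p-integral
    terms that can be expanded in powers of p (tail_term_expand).

    Write H(a) = H_{p-1}(a), H(a,b) = sum_{i<j<p} i^-a j^-b and B = B_{p-5}.
    For p > 5 the nested sums are computed from three sources.
    - The substitution k -> p-k. It relates H(1), H(2), H(3), H(4)
      (harmonic1_harmonic2), and shows that the sums of weight five and depth
      three drop out or reduce to depth two (triple_sum_112, triple_sum_221).
    - Duality. The transform a -> sum_k (-1)^(k-1) C(n,k) a_k turns division by k
      into summation; at n = p its weights are p/k prod_{j<k} (1 - p/j), hence
      close to p/k. This gives 5 H(4) = 4 p H(1,4) mod p^2 (harmonic4_double_sum)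
      and the sum of H_k(1)/k^2 modulo p^3 (star_sum12).
    - Faulhaber's formula with Fermat's little theorem: modulo p, H(1,4) = B,
      H(2,3) = -2B, and the sum of k^-5 over k < p/2 is -6B because
      B_n(1/2) = (2^(1-n) - 1) B_n. The last value settles the alternating sum,
      which k -> p-k lowers to weight five (alternating_sum4).
    Adding up, the alternating part contributes -3/2 p B and the tail
    3 H(1)/p^3 + 3/10 p B (leshchiner_pdvd).

    For p = 5 this breaks down, since p-1 = 4 and H(4) is a unit modulo 5; there
    both sides are explicit rational numbers (leshchiner_five). *)

(** * The ring of p-integral rationals and its ideals *)

Definition pint (p : nat) : {pred rat} := [pred x | coprime `|denq x| p].

(** The ideal p^r Z_(p); congruences modulo p^r are memberships of differences. *)
Definition pdvd (p r : nat) : {pred rat} := [pred x | x / p%:R ^+ r \in pint p].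

(** Integrality can be tested on any fraction, not only the reduced one. *)
Lemma pint_frac p (x : rat) (a : int) (b : nat) :
  coprime b p -> b != 0%N -> b%:R * x = a%:~R -> x \in pint p.
Proof.
move=> cop b0 e; rewrite inE; apply: coprime_dvdl cop.
have h : (b%:Z * numq x)%R = (a * denq x)%R.
  apply: (@intr_inj rat); rewrite !intrM /= -e -pmulrn -mulrA; congr (_ * _).
  by rewrite -{2}(divq_num_den x) divfK // intr_eq0 denq_neq0.
rewrite -(@Gauss_dvdl _ _ `|numq x|); last by rewrite coprime_sym coprime_num_den.
by rewrite -[b]absz_nat -abszM h abszM dvdn_mull.
Qed.

Lemma absz_denqM (x : rat) : `|denq x|%:R * x = (numq x)%:~R.
Proof.
rewrite -[X in X * _ = _]/(`|denq x|%:R) pmulrn gez0_abs ?denq_ge0 //.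
by rewrite -{2}(divq_num_den x) mulrC divfK // intr_eq0 denq_neq0.
Qed.

Lemma pint_subring p : subring_closed (pint p).
Proof.
have d0 (x : rat) : (`|denq x| != 0)%N by rewrite absz_eq0 denq_neq0.
split=> [|x y hx hy|x y hx hy].
- by rewrite inE coprime1n.
- apply: (@pint_frac p _ (numq x * `|denq y| - numq y * `|denq x|) (`|denq x| * `|denq y|)).
  + by rewrite coprimeMl; apply/andP; split.
  + by rewrite muln_eq0 negb_or !d0.
  + rewrite intrB !intrM -!absz_denqM natrM -!pmulrn; ring.
- apply: (@pint_frac p _ (numq x * numq y) (`|denq x| * `|denq y|)).
  + by rewrite coprimeMl; apply/andP; split.
  + by rewrite muln_eq0 negb_or !d0.
  + rewrite !intrM -!absz_denqM natrM; ring.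
Qed.
HB.instance Definition _ p := GRing.isSubringClosed.Build rat (pint p) (pint_subring p).

Lemma pdvd_zmod p r : zmod_closed (pdvd p r).
Proof.
by split=> [|x y hx hy]; rewrite inE ?mul0r ?rpred0 // mulrBl; apply: rpredB.
Qed.
HB.instance Definition _ p r := GRing.isZmodClosed.Build rat (pdvd p r) (pdvd_zmod p r).

Lemma pdvd0E p : pdvd p 0 =i pint p.
Proof. by move=> x; rewrite !inE expr0 divr1. Qed.

Lemma pint_natV p n : coprime n p -> n%:R^-1 \in pint p.
Proof.
case: n => [|n] cop; first by rewrite invr0 rpred0.
by apply: (@pint_frac p _ 1 n.+1) => //; rewrite mulfV ?pnatr_eq0.
Qed.

Lemma coprime_lt_prime p k : prime p -> (0 < k < p)%N -> coprime k p.
Proof.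
by move=> pp /andP[k0 kp]; rewrite coprime_sym prime_coprime // gtnNdvd.
Qed.

Lemma pdvdM p r s x y : x \in pdvd p r -> y \in pdvd p s -> x * y \in pdvd p (r + s).
Proof.
move=> hx hy; rewrite inE exprD invfM mulrACA; exact: rpredM.
Qed.

Lemma pdvd_mulr p r x y : x \in pdvd p r -> y \in pint p -> x * y \in pdvd p r.
Proof. by move=> hx hy; rewrite -[r]addn0 pdvdM // pdvd0E. Qed.

Lemma pdvd_mull p r x y : x \in pint p -> y \in pdvd p r -> x * y \in pdvd p r.
Proof. by move=> hx hy; rewrite mulrC pdvd_mulr. Qed.

Lemma pdvd_exp p r : p%:R ^+ r \in pdvd p r.
Proof.
rewrite inE; have [->|p0] := eqVneq (p%:R ^+ r : rat) 0; first by rewrite mul0r rpred0.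
by rewrite mulfV // rpred1.
Qed.

Lemma pdvdW p r s x : (0 < p)%N -> (s <= r)%N -> x \in pdvd p r -> x \in pdvd p s.
Proof.
move=> p_gt0 /subnK <- h; rewrite inE.
have p0 : p%:R != 0 :> rat by rewrite pnatr_eq0 -lt0n.
have -> : x / p%:R ^+ s = x / p%:R ^+ (r - s + s) * p%:R ^+ (r - s).
  by rewrite exprD; field; rewrite !expf_neq0.
by apply: rpredM => //; rewrite rpredX // rpred_nat.
Qed.

Lemma pdvd_cancel p r s x : (0 < p)%N ->
  (p%:R ^+ s * x \in pdvd p (s + r)) = (x \in pdvd p r).
Proof.
move=> p_gt0; have p0 : p%:R != 0 :> rat by rewrite pnatr_eq0 -lt0n.
by rewrite !inE exprD invfM mulrACA mulfV ?expf_neq0 // mul1r.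
Qed.

Lemma pdvdI p r x y : (0 < p)%N -> y \in pint p -> x = p%:R ^+ r * y -> x \in pdvd p r.
Proof. by move=> p_gt0 hy ->; rewrite -{2}[r]addn0 pdvd_cancel // pdvd0E. Qed.

Lemma pdvd_rat_eqmod p r (x y : rat) : prime p -> x - y \in pdvd p r -> rat_eqmod p r x y.
Proof.
move=> p_prime; have p_gt0 := prime_gt0 p_prime.
have [/eqP|xy0] := eqVneq (x - y) 0; first by rewrite subr_eq0 => /eqP; left.
move=> hz; right; rewrite /padic_val; move: (x - y) xy0 hz => {x y} z z0 hz.
have p0 : p%:R != 0 :> rat by rewrite pnatr_eq0 -lt0n.
set u := z / p%:R ^+ r; have {hz} hu : coprime `|denq u| p by [].
have d0 (x : rat) : (0 < `|denq x|)%N by rewrite absz_gt0 denq_neq0.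
have den (x : rat) : (denq x)%:~R = `|denq x|%:R :> rat.
  by rewrite pmulrn gez0_abs ?denq_ge0.
have n0 (x : rat) : x != 0 -> (0 < `|numq x|)%N by rewrite absz_gt0 numq_eq0.
have u0 : u != 0 by rewrite mulf_neq0 ?invr_eq0 ?expf_neq0.
have h : (numq z * denq u)%R = ((p ^ r)%N%:Z * numq u * denq z)%R.
  apply: (@intr_inj rat); rewrite !intrM -!absz_denqM !den -pmulrn natrX.
  have ez : z = p%:R ^+ r * u by rewrite /u mulrC divfK ?expf_neq0.
  by rewrite [X in _ * X * `|denq u|%:R]ez; ring.
have {h} h : (`|numq z| * `|denq u| = p ^ r * `|numq u| * `|denq z|)%N.
  by rewrite -abszM h !abszM absz_nat.
have := congr1 (logn p) h; rewrite !lognM ?muln_gt0 ?expn_gt0 ?p_gt0 ?d0 ?n0 //.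
have -> : logn p `|denq u| = 0%N by apply: logn_coprime; rewrite coprime_sym.
rewrite (pfactorK r p_prime); lia.
Qed.

(** * Harmonic numbers and alternating binomial sums *)

Lemma harmonicS n a : harmonic n.+1 a = harmonic n a + (n.+1%:R ^+ a)^-1.
Proof. by rewrite /harmonic big_nat_recr. Qed.

Lemma harmonic0 a : harmonic 0 a = 0.
Proof. by rewrite /harmonic big_geq. Qed.

Lemma harmonic_pred p a : (0 < p)%N ->
  harmonic p.-1 a = \sum_(1 <= k < p) (k%:R ^+ a)^-1.
Proof. by move=> p_gt0; rewrite /harmonic prednK. Qed.

Lemma harmonic_rec k a : (0 < k)%N ->
  harmonic k a = harmonic k.-1 a + (k%:R ^+ a)^-1.
Proof. by case: k => // k _; rewrite harmonicS. Qed.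

(** The square of pairs of indices is cut along its diagonal, which goes to the
    first sum. *)
Lemma harmonicM n a b :
  harmonic n a * harmonic n b =
  \sum_(1 <= k < n.+1) harmonic k a / k%:R ^+ b
  + \sum_(1 <= k < n.+1) harmonic k.-1 b / k%:R ^+ a.
Proof.
elim: n => [|n IH]; first by rewrite harmonic0 mul0r !big_geq // addr0.
rewrite !harmonicS [in RHS]big_nat_recr //= [X in _ = _ + X]big_nat_recr //= !harmonicS.
set S1 := \sum_(_ <= _ < _) _ in IH *; set S2 := \sum_(_ <= _ < _) _ in IH *.
have -> : S1 = harmonic n a * harmonic n b - S2 by rewrite IH addrK.
by ring.
Qed.

(** The binomial transform, an involution on sequences indexed from 1, which carries the
    duality of multiple harmonic sums. *)
Definition altbin (a : nat -> rat) (n : nat) : rat :=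
  \sum_(1 <= k < n.+1) (-1) ^+ k.-1 * 'C(n, k)%:R * a k.

(** Pascal's rule followed by a shift of the index: summation by parts for the
    transform. *)
Lemma altbin_diff (a : nat -> rat) n : a 0%N = 0 ->
  altbin a n.+1 = \sum_(0 <= j < n.+1) (-1) ^+ j * 'C(n, j)%:R * (a j.+1 - a j).
Proof.
move=> a0; rewrite /altbin big_add1 /=.
under [RHS]eq_bigr do rewrite mulrBr.
rewrite sumrB [X in _ = _ - X]big_nat_recl //= a0 mulr0 add0r.
under eq_bigr do rewrite binS natrD mulrDr mulrDl.
rewrite big_split /= big_nat_recr //= bin_small // mulr0 mul0r addr0 addrC.
congr (_ + _); rewrite -sumrN; apply: eq_bigr => j _.
by rewrite exprS !mulN1r !mulNr opprK.
Qed.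

Lemma altbin_const1 n : altbin (fun=> 1) n.+1 = 1.
Proof.
(* The value at 0 is free, and with 0 there the differences are a Kronecker delta. *)
transitivity (altbin (fun k => (k != 0%N)%:R) n.+1).
  by rewrite /altbin !big_add1; apply: eq_bigr.
rewrite altbin_diff // big_nat_recl //= big1 => [|j _]; last by rewrite subrr mulr0.
by rewrite expr0 bin0 subr0 addr0 !mulr1.
Qed.

(** From n to n+1 the transform of a_k/k grows by the terms
    C(n,k-1)/k = C(n+1,k)/(n+1), that is, by one value of the transform of a. *)
Lemma altbin_div (a : nat -> rat) n :
  altbin (fun k => a k / k%:R) n = \sum_(1 <= j < n.+1) altbin a j / j%:R.
Proof.
elim: n => [|n IH]; first by rewrite /altbin !big_geq.
rewrite big_nat_recr //= -IH {1}/altbin.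
have -> : altbin (fun k => a k / k%:R) n =
    \sum_(1 <= k < n.+2) (-1) ^+ k.-1 * 'C(n, k)%:R * (a k / k%:R).
  by rewrite [RHS]big_nat_recr //= bin_small // mulr0 mul0r addr0.
rewrite /altbin mulr_suml -big_split /=.
rewrite big_nat_cond [RHS]big_nat_cond.
apply: eq_bigr => -[|k] // /andP[/andP[_ kn] _].
have e : n.+1%:R * 'C(n, k.+1)%:R = (n.+1%:R - k.+1%:R) * 'C(n.+1, k.+1)%:R :> rat.
  by rewrite -natrB // -!natrM; congr _%:R; rewrite -mul_bin_down.
have n0 : n.+1%:R != 0 :> rat by rewrite pnatr_eq0.
have -> : 'C(n, k.+1)%:R = (n.+1%:R - k.+1%:R) * 'C(n.+1, k.+1)%:R / n.+1%:R :> rat.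
  by rewrite -e mulrC mulKf.
by field; rewrite !nat1r !pnatr_eq0.
Qed.

Lemma altbin_inv n : altbin (fun k => k%:R^-1) n = harmonic n 1.
Proof.
have -> : altbin (fun k => k%:R^-1) n = altbin (fun k => 1 / k%:R) n.
  by apply: eq_bigr => k _; rewrite div1r.
rewrite altbin_div /harmonic !big_add1; apply: eq_bigr => j _.
by rewrite altbin_const1 div1r expr1.
Qed.

Lemma altbin_inv_sqr n :
  altbin (fun k => (k%:R ^+ 2)^-1) n = \sum_(1 <= j < n.+1) harmonic j 1 / j%:R.
Proof.
have -> : altbin (fun k => (k%:R ^+ 2)^-1) n = altbin (fun k => k%:R^-1 / k%:R) n.
  by apply: eq_bigr => k _; rewrite expr2 invfM.
by rewrite altbin_div; apply: eq_bigr => j _; rewrite altbin_inv.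
Qed.

(** The converse of the rule for division: the differences of H_k(2) are
    1/k^2, and C(n,k-1)/k^2 = C(n+1,k)/((n+1) k). *)
Lemma altbin_harmonic2 n : altbin (fun k => harmonic k 2) n.+1 = harmonic n.+1 1 / n.+1%:R.
Proof.
rewrite altbin_diff ?harmonic0 // -altbin_inv /altbin big_add1 mulr_suml /=.
apply: eq_bigr => j _; rewrite harmonicS [harmonic j 2 + _]addrC addrK.
have n0 : n.+1%:R != 0 :> rat by rewrite pnatr_eq0.
have -> : 'C(n, j)%:R = j.+1%:R * 'C(n.+1, j.+1)%:R / n.+1%:R :> rat.
  by rewrite -natrM -mul_bin_diag natrM mulrC mulKf.
by field; rewrite !nat1r !pnatr_eq0.
Qed.

Lemma altbin_harmonic2_div n :
  altbin (fun k => harmonic k 2 / k%:R) n = \sum_(1 <= j < n.+1) harmonic j 1 / j%:R ^+ 2.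
Proof.
rewrite altbin_div !big_add1; apply: eq_bigr => j _ /=.
by rewrite altbin_harmonic2 expr2 invfM mulrA.
Qed.

(** * A finite form of Leshchiner's series for zeta(4) *)

(** The summand of the tail, without its factor H_{k-1}(2). *)
Definition tail_term (n k : nat) : rat :=
  (-1) ^+ (n + k) / (k%:R ^+ 2 * 'C(n, k)%:R * 'C(n + k, k)%:R).

(** A Wilf-Zeilberger certificate for the dependence of tail_term on n: if D_k
    is the increment of tail_term at k from n-1 to n, then tail_cert n k is k^2 D_k,
    and n^2 D_k is a difference of consecutive certificates. *)
Definition tail_cert (n k : nat) : rat :=
  (-1) ^+ (n + k) * 2 * n%:R / ((n%:R - k%:R) * 'C(n, k)%:R * 'C(n + k, k)%:R).

Lemma bin_neq0 n k : (k <= n)%N -> 'C(n, k)%:R != 0 :> rat.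
Proof. by move=> kn; rewrite pnatr_eq0 -lt0n bin_gt0. Qed.

Lemma tail_cert_diff_sqr n k : (0 < k <= n)%N ->
  tail_term n.+1 k - tail_term n k = tail_cert n.+1 k / k%:R ^+ 2.
Proof.
case/andP=> k0 kn; rewrite /tail_term /tail_cert.
have n0 : n.+1%:R != 0 :> rat by rewrite pnatr_eq0.
have nk0 : (n.+1 + k)%:R != 0 :> rat by rewrite pnatr_eq0.
have kR0 : k%:R != 0 :> rat by rewrite pnatr_eq0 -lt0n.
have d0 : n.+1%:R - k%:R != 0 :> rat by rewrite -natrB ?pnatr_eq0 ?subn_eq0 -?ltnNge // ltnW.
have b1 := bin_neq0 (leqW kn).
have b2 := bin_neq0 (leq_addl n.+1 k).
have e1 : 'C(n, k)%:R = (n.+1%:R - k%:R) * 'C(n.+1, k)%:R / n.+1%:R :> rat.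
  by rewrite -natrB ?leqW // -natrM -mul_bin_down natrM mulrC mulKf.
have e2 : 'C(n + k, k)%:R = n.+1%:R * 'C(n.+1 + k, k)%:R / (n.+1 + k)%:R :> rat.
  have := mul_bin_down (n.+1 + k) k; rewrite addnK addSn => /= e.
  by rewrite -natrM -e natrM mulrC mulKf.
rewrite e1 e2 addSn exprS; move: nk0 b1 b2; rewrite -addSn natrD.
move: ('C(_, _)%:R) ('C(_, _)%:R) => B1 B2.
move: (n.+1%:R) n0 k%:R kR0 d0 => N N0 K K0 NK0 SN0 b1 b2; field.
by rewrite K0 b1 b2 NK0 SN0 N0.
Qed.

Lemma tail_cert_diff n k : (k.+1 < n)%N ->
  tail_cert n k.+1 - tail_cert n k = n%:R ^+ 2 * (tail_cert n k.+1 / k.+1%:R ^+ 2).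
Proof.
move=> kn; rewrite /tail_cert.
have nR0 : n%:R != 0 :> rat by rewrite pnatr_eq0; case: n kn.
have k1R0 : k.+1%:R != 0 :> rat by rewrite pnatr_eq0.
have nk0 : n%:R + k.+1%:R != 0 :> rat by rewrite -natrD pnatr_eq0 addnS.
have d0 : n%:R - k%:R != 0 :> rat.
  by rewrite -natrB ?pnatr_eq0 ?subn_eq0 -?ltnNge // ltnW // ltnW.
have d1 : n%:R - k.+1%:R != 0 :> rat.
  by rewrite -natrB ?pnatr_eq0 ?subn_eq0 -?ltnNge // ltnW.
have b1 := bin_neq0 (ltnW (ltnW kn)).
have b2 := bin_neq0 (leq_addl n k).
have e1 : 'C(n, k.+1)%:R = (n%:R - k%:R) * 'C(n, k)%:R / k.+1%:R :> rat.
  by rewrite -natrB ?(ltnW (ltnW kn)) // -natrM -mul_bin_left natrM mulrC mulKf.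
have e2 : 'C(n + k.+1, k.+1)%:R = (n%:R + k.+1%:R) * 'C(n + k, k)%:R / k.+1%:R :> rat.
  by have /= e := mul_bin_diag (n + k).+1 k; rewrite -natrD -natrM addnS e natrM mulrC mulKf.
rewrite e1 e2 addnS exprS; move: b1 b2 d1 nk0 k1R0; rewrite -natr1.
move: ('C(_, _)%:R) ('C(_, _)%:R) => B1 B2.
move: n%:R nR0 k%:R d0 => N N0 K NK0 b1 b2 d1 SN0 K0; field.
by rewrite ?K0 ?b1 ?b2 ?NK0 ?SN0 ?d1.
Qed.

Lemma tail_cert0 n : (0 < n)%N -> tail_cert n 0 = 2 * (-1) ^+ n.
Proof.
move=> n0; rewrite /tail_cert addn0 !bin0 subr0; field.
by rewrite pnatr_eq0 -lt0n.
Qed.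

Lemma tail_cert_pred n : tail_cert n.+1 n = - 4 / 'C(2 * n.+1, n.+1)%:R.
Proof.
rewrite /tail_cert; have b2 := bin_neq0 (leq_addl n.+1 n).
have n0 : n.+1%:R != 0 :> rat by rewrite pnatr_eq0.
have -> : 'C(2 * n.+1, n.+1)%:R = 2 * 'C(n.+1 + n, n)%:R :> rat.
  apply: (mulfI n0); rewrite -!natrM; congr _%:R.
  have := mul_bin_diag (2 * n.+1) n; rewrite [(2 * n.+1).-1](_ : _ = n.+1 + n)%N; lia.
move: ('C(n.+1 + n, n)%:R) b2 => b b0.
rewrite binSn addSn exprS addnn -mul2n exprM sqrrN !expr1n -natrB //.
by rewrite subSn // subnn; field; rewrite b0 nat1r pnatr_eq0.
Qed.

(** Abel summation: the increments of H_{k-1}(2) leave c_k/k^2, which for the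
    certificate is again a telescoping summand. *)
Lemma sum_by_parts_harmonic2 (c : nat -> rat) m :
  \sum_(1 <= k < m.+1) harmonic k.-1 2 * (c k - c k.-1) =
  harmonic m 2 * c m - \sum_(1 <= k < m.+1) c k / k%:R ^+ 2.
Proof.
elim: m => [|m IH]; first by rewrite !big_geq // harmonic0 mul0r subr0.
rewrite big_nat_recr //= IH [X in _ = _ - X]big_nat_recr //= harmonicS; ring.
Qed.

(** The coefficient of x^2 in the finite form of
    sum_k (3k^2+x^2) / (k^2 C(2k,k) (k^2-x^2)) prod_{m<k} (1-x^2/m^2)
      = 2 sum_k (-1)^(k-1)/(k^2-x^2).
    By induction on n, the tail increases by its new last term and by the
    telescoped increments of the previous ones, whose boundary values at k = n
    and k = 0 are the new central binomial terms and the new alternating term. *)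
Lemma leshchiner_finite n :
  4 * (\sum_(1 <= k < n.+1) (k%:R ^+ 4 * 'C(2 * k, k)%:R)^-1)
  - 3 * (\sum_(1 <= k < n.+1) harmonic k.-1 2 / (k%:R ^+ 2 * 'C(2 * k, k)%:R))
  = 2 * (\sum_(1 <= k < n.+1) (-1) ^+ k.-1 / k%:R ^+ 4)
    + \sum_(1 <= k < n.+1) harmonic k.-1 2 * tail_term n k.
Proof.
elim: n => [|n IH]; first by rewrite !big_geq // !mulr0 subr0 addr0.
have n0 : n.+1%:R != 0 :> rat by rewrite pnatr_eq0.
have tel : \sum_(1 <= k < n.+1) tail_cert n.+1 k / k%:R ^+ 2 =
    (tail_cert n.+1 n - tail_cert n.+1 0) / n.+1%:R ^+ 2.
  rewrite -(@telescope_sumr _ 0 n (tail_cert n.+1)) // big_add1 mulr_suml /=.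
  rewrite big_nat_cond [RHS]big_nat_cond; apply: eq_bigr => k /andP[/andP[_ kn] _].
  by rewrite tail_cert_diff // [X in _ = X / _]mulrC mulfK // expf_neq0.
have diff : \sum_(1 <= k < n.+1) harmonic k.-1 2 * tail_term n.+1 k
    - \sum_(1 <= k < n.+1) harmonic k.-1 2 * tail_term n k
  = (harmonic n 2 * tail_cert n.+1 n - (tail_cert n.+1 n - tail_cert n.+1 0) / n.+1%:R ^+ 2)
    / n.+1%:R ^+ 2.
  rewrite -tel -sum_by_parts_harmonic2 -sumrB mulr_suml.
  rewrite big_nat_cond [RHS]big_nat_cond; apply: eq_bigr => -[|k] // /andP[/andP[_ kn] _].
  by rewrite -mulrBr tail_cert_diff_sqr // tail_cert_diff //=; field; rewrite !nat1r !pnatr_eq0.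
move: diff; rewrite tail_cert0 // tail_cert_pred => /(canRL (subrK _)) diff.
have recr (F : nat -> rat) :
    \sum_(1 <= k < n.+2) F k = \sum_(1 <= k < n.+1) F k + F n.+1.
  by rewrite big_nat_recr.
rewrite !recr mulrDr [3 * _]mulrDr opprD addrACA IH diff mulrDr.
rewrite /tail_term binn mulr1 addnn -mul2n exprM sqrrN !expr1n [(-1) ^+ n.+1]exprS /=.
have b0 := bin_neq0 (leq_addl n.+1 n.+1).
move: b0; rewrite addnn -mul2n.
move: ('C(_, _)%:R) (n.+1%:R) n0 => B N N0 B0; field.
by rewrite N0 B0.
Qed.

(** * Bernoulli polynomials *)

(** The product of the exponential generating functions of f and g. *)
Definition bconv (f g : nat -> rat) (n : nat) : rat :=
  \sum_(i < n.+1) 'C(n, i)%:R * f i * g (n - i)%N.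

(** The generating function truncated in degree N: associativity of bconv is then
    inherited from the ring of polynomials. *)
Definition egf (N : nat) (f : nat -> rat) : {poly rat} :=
  \poly_(i < N.+1) (f i / i`!%:R).

Lemma fact_neq0 m : m`!%:R != 0 :> rat.
Proof. by rewrite pnatr_eq0 -lt0n fact_gt0. Qed.

Lemma bin_fact_div n i : (i <= n)%N ->
  'C(n, i)%:R = n`!%:R / i`!%:R / (n - i)`!%:R :> rat.
Proof.
move=> le_in; rewrite -(bin_fact le_in) !natrM; field.
by rewrite !fact_neq0.
Qed.

Lemma coef_egfM N f g n : (n <= N)%N ->
  (egf N f * egf N g)`_n = bconv f g n / n`!%:R.
Proof.
move=> le_nN; rewrite coefM /bconv mulr_suml; apply: eq_bigr => -[i] /= lt_in _.
rewrite !coef_poly !ltnS (leq_trans _ le_nN) // (leq_trans (leq_subr _ _) le_nN).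
by rewrite bin_fact_div //; field; rewrite !fact_neq0.
Qed.

Lemma bconvC f g n : bconv f g n = bconv g f n.
Proof.
apply: (mulIf (invr_neq0 (fact_neq0 n))).
by rewrite -!(@coef_egfM n) // mulrC.
Qed.

Lemma eq_bconv f f' g g' n : f =1 f' -> g =1 g' -> bconv f g n = bconv f' g' n.
Proof. by move=> ef eg; apply: eq_bigr => i _; rewrite ef eg. Qed.

Lemma bconvA f g h n : bconv f (bconv g h) n = bconv (bconv f g) h n.
Proof.
apply: (mulIf (invr_neq0 (fact_neq0 n))).
have trunc u v w : bconv (bconv u v) w n / n`!%:R = (egf n u * egf n v * egf n w)`_n.
  rewrite -(@coef_egfM n) // !coefM; apply: eq_bigr => -[i] /= lt_in _.
  by rewrite (@coef_egfM n) // coef_poly lt_in.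
by rewrite bconvC !trunc [egf n g * _ * _]mulrC mulrA.
Qed.

Lemma bconv_exp (x y : rat) n :
  bconv (fun i => x ^+ i) (fun i => y ^+ i) n = (x + y) ^+ n.
Proof.
rewrite addrC exprDn; apply: eq_bigr => i _.
by rewrite -mulr_natl; ring.
Qed.

Lemma bconvDl f f' g n : bconv (fun i => f i + f' i) g n = bconv f g n + bconv f' g n.
Proof. by rewrite -big_split; apply: eq_bigr => i _; rewrite mulrDr mulrDl. Qed.

Lemma bernoulli_rec n : \sum_(i < n) 'C(n, i)%:R * bernoulli i = (n == 1%N)%:R.
Proof.
have := bernoulli_gf n; rewrite /fps_mul big_ord_recr /= subnn subrr mulr0 addr0.
move=> /(congr1 (fun x => n`!%:R * x)); have -> : n`!%:R * (n == 1%N)%:R = (n == 1%N)%:R :> rat.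
  by case: eqP => [->|_]; rewrite ?mulr1 ?mulr0.
move=> <-; rewrite mulr_sumr; apply: eq_bigr => -[i] /= lt_in _.
rewrite subn_eq0 leqNgt lt_in subr0 bin_fact_div ?(ltnW lt_in) //.
by field; rewrite !fact_neq0.
Qed.

Lemma bernoulli_rec_uniq (b : nat -> rat) :
  (forall n, \sum_(i < n) 'C(n, i)%:R * b i = (n == 1%N)%:R) -> b =1 bernoulli.
Proof.
move=> rec n; have [m] := ubnP n; elim: m n => // m IH n; rewrite ltnS => le_nm.
have := rec n.+1; rewrite -(bernoulli_rec n.+1) !big_ord_recr /= binSn.
under eq_bigr => i _ do rewrite (IH i (leq_trans (ltn_ord i) le_nm)).
by move/addrI/mulfI; apply; rewrite pnatr_eq0.
Qed.

Lemma bernoulli0 : bernoulli 0 = 1.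
Proof. by have := bernoulli_rec 1; rewrite big_ord1 bin0 mul1r. Qed.

Definition bernpoly (n : nat) (x : rat) : rat := bconv bernoulli (fun i => x ^+ i) n.

Lemma bernpoly0 n : bernpoly n 0 = bernoulli n.
Proof.
rewrite /bernpoly /bconv big_ord_recr /= subnn expr0 mulr1 binn mul1r big1 ?add0r //.
by move=> [i] /= lt_in _; rewrite expr0n subn_eq0 leqNgt lt_in mulr0.
Qed.

Lemma bernpoly1 n : bernpoly n 1 = bernoulli n + (n == 1%N)%:R.
Proof.
rewrite /bernpoly /bconv big_ord_recr /= subnn expr0 mulr1 binn mul1r addrC -bernoulli_rec.
by congr (_ + _); apply: eq_bigr => i _; rewrite expr1n mulr1.
Qed.

Lemma bernpolyD n (x y : rat) :
  bernpoly n (x + y) = bconv (bernpoly^~ x) (fun i => y ^+ i) n.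
Proof.
rewrite /bernpoly -bconvA; apply: eq_bconv => // i; exact/esym/bconv_exp.
Qed.

(** The convolution of B with the constant sequence 1 is B except at index 1, so
    translation by 1 adds a single term. *)
Lemma bernpolyS n (x : rat) : bernpoly n (1 + x) = bernpoly n x + n%:R * x ^+ n.-1.
Proof.
rewrite bernpolyD (eq_bconv _ bernpoly1 (frefl _)) bconvDl; congr (_ + _).
case: n => [|n]; first by rewrite /bconv big_ord1 /= mulr0 !mul0r.
rewrite /bconv (bigD1 (inord 1)) //= inordK // eqxx bin1 mulr1 subn1 big1 ?addr0 //.
move=> i; rewrite -(inj_eq val_inj) /= inordK // => /negPf ->.
by rewrite mulr0 mul0r.
Qed.

Lemma faulhaber n m :
  n%:R * (\sum_(0 <= i < m) i%:R ^+ n.-1) = bernpoly n m%:R - bernoulli n.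
Proof.
elim: m => [|m IH]; first by rewrite big_geq // mulr0 bernpoly0 subrr.
by rewrite big_nat_recr //= mulrDr IH -nat1r bernpolyS addrAC.
Qed.

(** The numbers 2^(n-1) (B_n(1/2) + B_n) satisfy the recurrence of the Bernoulli
    numbers, because translating B_n and B_n(1/2) by 1/2 gives B_n(1/2) and B_n(1). *)
Lemma bernpoly_half n : bernpoly n 2^-1 = (2 / 2 ^+ n - 1) * bernoulli n.
Proof.
have two0 : 2 != 0 :> rat by [].
suff h : (fun i => 2 ^+ i / 2 * (bernpoly i 2^-1 + bernoulli i)) =1 bernoulli.
  rewrite mulrBl mul1r -{1}(h n); field; exact: expf_neq0.
apply: bernoulli_rec_uniq => N.
have : bconv (fun i => 2 ^+ i / 2 * (bernpoly i 2^-1 + bernoulli i)) (fun i => 1 ^+ i) N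
   = 2 ^+ N / 2 * (bernpoly N 1 + bernpoly N 2^-1).
  have -> : bernpoly N 1 = bconv (bernpoly^~ 2^-1) (fun i => 2^-1 ^+ i) N.
    by rewrite -bernpolyD; congr bernpoly.
  rewrite -[bernpoly N 2^-1]/(bconv bernoulli (fun i => 2^-1 ^+ i) N) -bconvDl mulr_sumr.
  apply: eq_bigr => -[i] /=; rewrite ltnS => le_iN _.
  have -> : 2 ^+ N = 2 ^+ (N - i) * 2 ^+ i :> rat by rewrite -exprD subnK.
  by rewrite expr1n exprVn; field; rewrite expf_neq0.
rewrite /bconv big_ord_recr /= subnn expr0 mulr1 binn mul1r.
under eq_bigr do rewrite expr1n mulr1.
move=> /(canRL (addrK _)) ->; rewrite bernpoly1.
by case: eqP => [->|_] /=; field.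
Qed.

(** The recurrence that yields B_m divides by m+1 < p at most. *)
Lemma bernoulli_pint p m : prime p -> (m.+1 < p)%N -> bernoulli m \in pint p.
Proof.
move=> p_prime; have [k] := ubnP m; elim: k m => // k IH m; rewrite ltnS => le_mk lt_mp.
have := bernoulli_rec m.+1; rewrite big_ord_recr /= binSn => /(canRL (addKr _)).
move=> /(congr1 ( *%R m.+1%:R^-1)); rewrite mulKf ?pnatr_eq0 // => ->.
apply: rpredM; first by apply/pint_natV/coprime_lt_prime.
rewrite rpredD ?rpred_nat // rpredN rpred_sum // => i _.
by rewrite rpredM ?rpred_nat // IH // ?(leq_trans (ltn_ord i)) // (leq_ltn_trans (ltn_ord i)) // ltnW.
Qed.

(** * Power sums and multiple harmonic sums modulo p *)

Lemma natr_neq0 k : (0 < k)%N -> k%:R != 0 :> rat.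
Proof. by rewrite pnatr_eq0 lt0n. Qed.

Section ModPrime.

Variable p : nat.
Hypothesis p_prime : prime p.

Let p_gt0 : (0 < p)%N. Proof. exact: prime_gt0. Qed.
Lemma pdvd_mulB r x x' y y' : x - x' \in pdvd p r -> y - y' \in pdvd p r ->
  x' \in pint p -> y \in pint p -> x * y - x' * y' \in pdvd p r.
Proof.
move=> hx hy ix iy; have -> : x * y - x' * y' = (x - x') * y + x' * (y - y') by ring.
by apply: rpredD; [exact: pdvd_mulr | exact: pdvd_mull].
Qed.

Lemma pdvd_exprB x y n : x - y \in pdvd p 1 -> x \in pint p -> y \in pint p ->
  x ^+ n - y ^+ n \in pdvd p 1.
Proof.
move=> hxy hx hy; rewrite subrXX pdvd_mulr // rpred_sum // => i _.
by rewrite rpredM ?rpredX.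
Qed.

Lemma pint_sum n (F : nat -> rat) :
  (forall k, (0 < k < n)%N -> F k \in pint p) -> \sum_(1 <= k < n) F k \in pint p.
Proof.
by move=> h; rewrite big_nat_cond rpred_sum // => k; rewrite andbT => /h.
Qed.

Lemma pdvd_sum r n (F : nat -> rat) :
  (forall k, (0 < k < n)%N -> F k \in pdvd p r) -> \sum_(1 <= k < n) F k \in pdvd p r.
Proof.
by move=> h; rewrite big_nat_cond rpred_sum // => k; rewrite andbT => /h.
Qed.

Lemma pdvd_sumB r n (F G : nat -> rat) :
  (forall k, (0 < k < n)%N -> F k - G k \in pdvd p r) ->
  \sum_(1 <= k < n) F k - \sum_(1 <= k < n) G k \in pdvd p r.
Proof. by move=> h; rewrite -sumrB; exact: pdvd_sum. Qed.

Lemma pdvd_p : p%:R \in pdvd p 1. Proof. by rewrite -[p%:R]expr1 pdvd_exp. Qed.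

Lemma pint_inv k : (0 < k < p)%N -> k%:R^-1 \in pint p.
Proof. by move=> hk; rewrite pint_natV // coprime_lt_prime. Qed.

Lemma pint_invX k a : (0 < k < p)%N -> (k%:R ^+ a)^-1 \in pint p.
Proof. by move=> hk; rewrite -exprVn rpredX // pint_inv. Qed.

Lemma pint_divX k a x : (0 < k < p)%N -> x \in pint p -> x / k%:R ^+ a \in pint p.
Proof. by move=> hk hx; rewrite rpredM // pint_invX. Qed.

Lemma pint_harmonic k a : (k < p)%N -> harmonic k a \in pint p.
Proof.
by move=> kp; rewrite pint_sum // => i /andP[i0 ik]; rewrite pint_invX // i0 (leq_trans ik).
Qed.

Lemma fermat_pdvd k : (0 < k < p)%N -> k%:R ^+ p.-1 - 1 \in pdvd p 1.
Proof.
move=> hk; have /andP[k0 _] := hk.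
have : (p %| k ^ p.-1 - 1)%N.
  rewrite -(@Gauss_dvdr _ k); last by rewrite coprime_sym coprime_lt_prime.
  rewrite mulnBr muln1 -expnS prednK // -eqn_mod_dvd ?fermat_little //.
  by rewrite -{1}[k]expn1 leq_pexp2l.
move=> /dvdnP[m e]; apply: (@pdvdI _ _ _ m%:R); rewrite ?rpred_nat // expr1.
by rewrite -natrX -(@natrB _ _ 1) ?expn_gt0 ?k0 // e natrM mulrC.
Qed.

Lemma inv_pdvd k a : (0 < k < p)%N -> (a < p)%N ->
  (k%:R ^+ a)^-1 - k%:R ^+ (p.-1 - a) \in pdvd p 1.
Proof.
move=> hk ap; have /andP[k0 _] := hk.
have -> : (k%:R ^+ a)^-1 - k%:R ^+ (p.-1 - a) = - ((k%:R ^+ a)^-1 * (k%:R ^+ p.-1 - 1)) :> rat.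
  rewrite -{2}(subnK (_ : a <= p.-1)%N); last by rewrite -ltnS prednK.
  by rewrite exprD; field; rewrite expf_neq0 // natr_neq0.
by rewrite rpredN pdvd_mull ?pint_invX // fermat_pdvd.
Qed.

(** Faulhaber's polynomial, evaluated at p, has no constant term, and for e < p-1
    its coefficients are p-integral. *)
Lemma power_sum_pdvd e : (0 < e < p.-1)%N -> \sum_(1 <= k < p) k%:R ^+ e \in pdvd p 1.
Proof.
case/andP=> e0 ep.
have e1p : (e.+1 < p)%N by rewrite -ltn_predRL.
have := faulhaber e.+1 p; rewrite big_ltn //= expr0n gtn_eqF // add0r.
move=> /(congr1 ( *%R e.+1%:R^-1)); rewrite mulKf ?pnatr_eq0 // => ->.
rewrite pdvd_mull ?pint_inv //.
rewrite /bernpoly /bconv big_ord_recr /= subnn expr0 mulr1 binn mul1r addrK.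
rewrite rpred_sum // => -[i] /= ie _; rewrite pdvd_mull //.
  by rewrite rpredM ?rpred_nat // bernoulli_pint // (leq_ltn_trans ie).
by rewrite (pdvdW p_gt0 (_ : 1 <= e.+1 - i)%N) ?subn_gt0 // pdvd_exp.
Qed.

Lemma harmonic_pdvd a : (0 < a < p.-1)%N -> harmonic p.-1 a \in pdvd p 1.
Proof.
case/andP=> a0 ap; rewrite harmonic_pred //.
rewrite -[X in X \in _](subrK (\sum_(1 <= k < p) k%:R ^+ (p.-1 - a))) rpredD //.
  apply: pdvd_sumB => k hk; rewrite inv_pdvd //.
  by rewrite (leq_trans ap) // leq_pred.
by apply: power_sum_pdvd; lia.
Qed.

(** Fermat's little theorem turns the negative powers into positive ones. The index
    0 contributes nothing since the exponent p-1-a is positive. *)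
Lemma harmonic_power_sum j a : (0 < j <= p)%N -> (a < p.-1)%N ->
  harmonic j.-1 a - \sum_(0 <= i < j) i%:R ^+ (p.-1 - a) \in pdvd p 1.
Proof.
case/andP=> j0 jp ap; rewrite big_ltn // expr0n subn_eq0 leqNgt ap add0r.
rewrite /harmonic prednK //; apply: pdvd_sumB => k /andP[k0 kj].
by rewrite inv_pdvd ?k0 ?(leq_trans kj) // (leq_trans ap) // leq_pred.
Qed.

(** Replace the inner sum by Faulhaber's polynomial in j. Each of its monomials
    leaves a sum of a power of j with exponent strictly between -(p-1) and p-1,
    which vanishes modulo p unless the exponent is 0: only B_{p-a-b} survives,
    with the value p-1 = -1 of that sum. *)
Lemma double_harmonic_pdvd a b : (0 < a)%N -> (0 < b)%N -> (a + b < p)%N ->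
  \sum_(1 <= j < p) harmonic j.-1 a / j%:R ^+ b
  + 'C(p - a, b)%:R / (p - a)%:R * bernoulli (p - (a + b)) \in pdvd p 1.
Proof.
move=> a0 b0 abp.
have ap : (a < p.-1)%N by lia.
have lp : (p - (a + b) < p - a)%N by lia.
(* The coefficient of j^(p-a-l) in Faulhaber's polynomial. *)
pose c l : rat := 'C(p - a, l)%:R * bernoulli l / (p - a)%:R.
have cint l : (l < p - a)%N -> c l \in pint p.
  move=> lpa; apply: rpredM; last by apply: pint_inv; lia.
  by apply: rpredM; [exact: rpred_nat | apply: bernoulli_pint => //; lia].
have inner l : (l < p - a)%N ->
    \sum_(1 <= j < p) j%:R ^+ (p - a - l) / j%:R ^+ b + (l == (p - (a + b))%N :> nat)%:R \in pdvd p 1.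
  move=> lpa; have [ll|ll|ll] := ltngtP l (p - (a + b)).
  - rewrite addr0 (eq_big_nat _ _ (F2 := fun j => j%:R ^+ (p - (a + b) - l))).
      by apply: power_sum_pdvd; lia.
    move=> j /andP[j0 _]; have -> : (p - a - l = p - (a + b) - l + b)%N by lia.
    by rewrite exprD mulfK // expf_neq0 // natr_neq0.
  - rewrite addr0 (eq_big_nat _ _ (F2 := fun j => (j%:R ^+ (l - (p - (a + b))))^-1)).
      by rewrite -harmonic_pred // harmonic_pdvd //; lia.
    move=> j /andP[j0 _]; rewrite {1}(_ : b = p - a - l + (l - (p - (a + b))))%N; last by lia.
    by rewrite exprD invfM mulrA mulfV ?mul1r // expf_neq0 // natr_neq0.
  - rewrite (eq_big_nat _ _ (F2 := fun=> 1)).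
      by rewrite big_const_nat iter_addr_0 natr1 subn1 prednK // pdvd_p.
    move=> j /andP[j0 _]; rewrite (_ : p - a - l = b)%N; last by lia.
    by rewrite mulfV // expf_neq0 // natr_neq0.
have powE j : \sum_(0 <= i < j) i%:R ^+ (p.-1 - a) = \sum_(l < p - a) c l * j%:R ^+ (p - a - l).
  have := faulhaber (p - a) j.
  rewrite /bernpoly /bconv big_ord_recr /= subnn expr0 mulr1 binn mul1r addrK.
  rewrite (_ : (p - a).-1 = p.-1 - a)%N; last by lia.
  move=> /(congr1 ( *%R (p - a)%:R^-1)); rewrite mulKf; last by apply: natr_neq0; lia.
  by move=> ->; rewrite mulr_sumr; apply: eq_bigr => l _; rewrite /c; ring.
pose S := \sum_(1 <= j < p) harmonic j.-1 a / j%:R ^+ b; rewrite -/S.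
pose S' := \sum_(1 <= j < p) (\sum_(0 <= i < j) i%:R ^+ (p.-1 - a)) / j%:R ^+ b : rat.
have SS' : S - S' \in pdvd p 1.
  apply: pdvd_sumB => j hj; rewrite -mulrBl pdvd_mulr ?pint_invX //.
  by rewrite harmonic_power_sum //; lia.
rewrite -[S](subrK S') -addrA rpredD //.
have -> : S' = \sum_(l < p - a) c l * \sum_(1 <= j < p) j%:R ^+ (p - a - l) / j%:R ^+ b.
  rewrite /S'; under eq_bigr do rewrite powE mulr_suml.
  by rewrite exchange_big; apply: eq_bigr => l _; rewrite mulr_sumr; apply: eq_bigr => j _; rewrite mulrA.
have -> : 'C(p - a, b)%:R / (p - a)%:R * bernoulli (p - (a + b)) =
    \sum_(l < p - a) c l * (l == (p - (a + b))%N :> nat)%:R.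
  rewrite (bigD1 (Ordinal lp)) //= eqxx mulr1 big1 => [|l].
    rewrite addr0 /c subnDA bin_sub; [ring | lia].
  by rewrite -(inj_eq val_inj) /= => /negPf ->; rewrite mulr0.
rewrite -big_split rpred_sum // => l _; rewrite /= -mulrDr.
by apply: pdvd_mull; [exact: cint | exact: inner].
Qed.

(** Faulhaber's polynomial is evaluated at (p+1)/2, which is 1/2 modulo p, and
    2 / 2^(p-a) is 2^a modulo p. *)
Lemma half_harmonic_pdvd a : odd p -> (1 < a < p.-1)%N ->
  harmonic p./2 a - (2 ^+ a - 2) / (p - a)%:R * bernoulli (p - a) \in pdvd p 1.
Proof.
move=> p_odd /andP[a1 ap].
have h1 : harmonic p./2 a - \sum_(0 <= i < (p./2).+1) i%:R ^+ (p.-1 - a) \in pdvd p 1.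
  by apply: (@harmonic_power_sum (p./2).+1) => //; lia.
rewrite -[harmonic _ _](subrK (\sum_(0 <= i < (p./2).+1) i%:R ^+ (p.-1 - a))) -addrA rpredD //.
have n0 : (p - a)%:R != 0 :> rat by apply: natr_neq0; lia.
have Bint l : (l <= p - a)%N -> bernoulli l \in pint p.
  by move=> la; apply: bernoulli_pint => //; lia.
have two0 : 2 != 0 :> rat by [].
have int2 : 2^-1 \in pint p by apply: pint_inv; lia.
have intV : (p - a)%:R^-1 \in pint p by apply: pint_inv; lia.
have -> : \sum_(0 <= i < (p./2).+1) i%:R ^+ (p.-1 - a) =
    (p - a)%:R^-1 * (bernpoly (p - a) (p./2).+1%:R - bernoulli (p - a)).
  rewrite -faulhaber mulKf //; rewrite (_ : (p - a).-1 = p.-1 - a)%N //; lia.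
have hB : bernpoly (p - a) (p./2).+1%:R - bernpoly (p - a) 2^-1 \in pdvd p 1.
  rewrite /bernpoly /bconv -sumrB rpred_sum // => -[l] /=; rewrite ltnS => la _.
  rewrite -mulrBr; apply: pdvd_mull; first by apply: rpredM; [exact: rpred_nat | exact: Bint].
  apply: pdvd_exprB => //; last exact: rpred_nat.
  apply: (@pdvdI _ _ _ 2^-1) => //; rewrite expr1.
  have -> : p%:R = 1 + 2 * (p./2)%:R :> rat.
    by rewrite -{1}(odd_double_half p) p_odd -mul2n natrD natrM.
  by rewrite -nat1r; field.
have hF := @fermat_pdvd 2 _.
have {}hF : 2 ^+ p.-1 - 1 \in pdvd p 1 by apply: hF; lia.
have e2 : 2 / 2 ^+ (p - a) - 2 ^+ a = - 2 ^+ a * (2 ^+ p.-1 - 1) / 2 ^+ p.-1 :> rat.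
  have -> : p.-1 = (p - a + a).-1 by congr _.-1; lia.
  have -> : (p - a + a).-1 = ((p - a).-1 + a)%N by lia.
  have {1}-> : (p - a = (p - a).-1.+1)%N by lia.
  rewrite exprS exprD; field; rewrite !expf_neq0 //.
have -> : (p - a)%:R^-1 * (bernpoly (p - a) (p./2).+1%:R - bernoulli (p - a))
    - (2 ^+ a - 2) / (p - a)%:R * bernoulli (p - a) =
  (p - a)%:R^-1 * (bernpoly (p - a) (p./2).+1%:R - bernpoly (p - a) 2^-1)
  + (p - a)%:R^-1 * bernoulli (p - a) * (2 / 2 ^+ (p - a) - 2 ^+ a).
  by rewrite bernpoly_half; ring.
apply: rpredD; first exact: pdvd_mull.
apply: pdvd_mull; first by apply: rpredM => //; exact: Bint.
rewrite e2 pdvd_mulr // ?pdvd_mull // ?rpredN ?rpredX // ?rpred_nat //.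
by rewrite -exprVn rpredX.
Qed.

End ModPrime.

(** * Congruences modulo higher powers of p *)

Section ModPrimePower.

Variable p : nat.
Hypothesis p_prime : prime p.
Hypothesis p_gt6 : (6 < p)%N.

Let p_gt0 : (0 < p)%N. Proof. exact: prime_gt0. Qed.
Let p_odd : odd p. Proof. by case: (even_prime p_prime) p_gt6 => // ->. Qed.
Let pR0 : p%:R != 0 :> rat. Proof. exact: natr_neq0. Qed.

Local Notation H a := (harmonic p.-1 a).

Lemma sum_rev (F : nat -> rat) : \sum_(1 <= k < p) F k = \sum_(1 <= k < p) F (p - k)%N.
Proof. by rewrite big_nat_rev. Qed.

Lemma natr_subp k : (0 < k < p)%N -> (p - k)%:R = - (k%:R - p%:R) :> rat.
Proof. by case/andP=> _ kp; rewrite natrB ?opprB // ltnW. Qed.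

Lemma subp_neq0 k : (0 < k < p)%N -> k%:R - p%:R != 0 :> rat.
Proof.
move=> hk; rewrite -oppr_eq0 -natr_subp // natr_neq0 // subn_gt0.
by case/andP: hk.
Qed.

Lemma pint_subpV k : (0 < k < p)%N -> (k%:R - p%:R)^-1 \in pint p.
Proof.
move=> hk; rewrite -rpredN -invrN -natr_subp // pint_inv //; lia.
Qed.

Lemma pdvd_div r s x : x \in pdvd p (s + r) -> x / p%:R ^+ s \in pdvd p r.
Proof.
by move=> hx; rewrite -(@pdvd_cancel p r s) // mulrC divfK // expf_neq0.
Qed.

Lemma harmonicE a : H a = \sum_(1 <= k < p) (k%:R ^+ a)^-1.
Proof. exact: harmonic_pred. Qed.

(** Under k -> p-k, H(1) becomes the sum of -1/(k-p), and
    1/(k-p) = 1/k + p/k^2 + p^2/k^3 + ... *)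
Lemma harmonic1_reversal :
  2 * H 1 + p%:R * H 2 + p%:R ^+ 2 * H 3 + p%:R ^+ 3 * H 4 + p%:R ^+ 4 * H 5 \in pdvd p 5.
Proof.
have -> : 2 * H 1 + p%:R * H 2 + p%:R ^+ 2 * H 3 + p%:R ^+ 3 * H 4 + p%:R ^+ 4 * H 5 =
   \sum_(1 <= k < p) p%:R ^+ 5 * - ((k%:R ^+ 5)^-1 * (k%:R - p%:R)^-1).
  rewrite mulr_natl mulr2n {1}harmonicE sum_rev !harmonicE !mulr_sumr -!big_split /=.
  apply: eq_big_nat => k hk; rewrite natr_subp //.
  have := subp_neq0 hk; have /andP[/natr_neq0] := hk.
  by move: (k%:R) => K K0 _ KP; field; rewrite K0 KP.
apply: pdvd_sum => k hk; rewrite pdvd_mulr ?pdvd_exp // rpredN.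
by rewrite rpredM ?pint_invX ?pint_subpV.
Qed.

Lemma harmonic3_reversal :
  2 * H 3 + 3 * p%:R * H 4 + 6 * p%:R ^+ 2 * H 5 \in pdvd p 3.
Proof.
have -> : 2 * H 3 + 3 * p%:R * H 4 + 6 * p%:R ^+ 2 * H 5 =
   (* The numerator is the rest of the cube of the geometric series after p^2. *)
   \sum_(1 <= k < p) p%:R ^+ 3 * - ((10 * k%:R ^+ 2 - 15 * p%:R * k%:R + 6 * p%:R ^+ 2)
       * ((k%:R ^+ 5)^-1 * ((k%:R - p%:R)^-1) ^+ 3)).
  rewrite mulr_natl mulr2n {1}harmonicE sum_rev !harmonicE !mulr_sumr -!big_split /=.
  apply: eq_big_nat => k hk; rewrite natr_subp //.
  have := subp_neq0 hk; have /andP[/natr_neq0] := hk.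
  by move: (k%:R) => K K0 _ KP; field; rewrite K0 KP.
apply: pdvd_sum => k hk; rewrite pdvd_mulr ?pdvd_exp // rpredN.
apply: rpredM; last by rewrite rpredM ?pint_invX ?rpredX ?pint_subpV.
by rewrite rpredD ?rpredB ?rpredM ?rpredX ?rpred_nat.
Qed.

Let H_p a : (0 < a < 6)%N -> H a \in pdvd p 1.
Proof. by move=> ha; apply: harmonic_pdvd => //; lia. Qed.

Let H_int a : H a \in pint p.
Proof. by apply: pint_harmonic => //; lia. Qed.

Let intV m : (0 < m < 7)%N -> m%:R^-1 \in pint p.
Proof. by move=> hm; apply: pint_inv => //; lia. Qed.

Lemma wolstenholme : H 1 \in pdvd p 2.
Proof.
have -> : H 1 = 2^-1 * ((2 * H 1 + p%:R * H 2 + p%:R ^+ 2 * H 3 + p%:R ^+ 3 * H 4 + p%:R ^+ 4 * H 5)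
   - p%:R ^+ 1 * H 2 - p%:R ^+ 2 * (H 3 + p%:R * H 4 + p%:R ^+ 2 * H 5)) by field.
rewrite pdvd_mull ?intV // !rpredB //.
- exact: pdvdW harmonic1_reversal.
- by rewrite (@pdvd_cancel _ 1 1) ?H_p.
- by rewrite pdvd_mulr ?pdvd_exp // !rpredD // rpredM ?rpredX ?rpred_nat.
Qed.

(** Substitute the relation of H(3) and H(4) into that of H(1), ..., H(5); H(5) is
    divisible by p. *)
Lemma harmonic1_harmonic2 : 2 * H 1 + p%:R * H 2 - p%:R ^+ 3 * H 4 / 2 \in pdvd p 5.
Proof.
have -> : 2 * H 1 + p%:R * H 2 - p%:R ^+ 3 * H 4 / 2 =
  (2 * H 1 + p%:R * H 2 + p%:R ^+ 2 * H 3 + p%:R ^+ 3 * H 4 + p%:R ^+ 4 * H 5)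
  - p%:R ^+ 2 * (2^-1 * (2 * H 3 + 3 * p%:R * H 4 + 6 * p%:R ^+ 2 * H 5))
  + p%:R ^+ 4 * (2 * H 5) by field.
apply: rpredD; first apply: rpredB.
- exact: harmonic1_reversal.
- by rewrite (@pdvd_cancel _ 3 2) // pdvd_mull ?intV // harmonic3_reversal.
- by rewrite (@pdvd_cancel _ 1 4) // pdvd_mull ?rpred_nat // H_p.
Qed.

Lemma inv_rev k a : (0 < k < p)%N ->
  ((p - k)%:R ^+ a)^-1 - (-1) ^+ a * (k%:R ^+ a)^-1 \in pdvd p 1.
Proof.
move=> hk; rewrite -!exprVn -exprMn mulN1r.
have hk' : (0 < p - k < p)%N by lia.
apply: pdvd_exprB => //; rewrite ?rpredN ?pint_inv //.
have -> : (p - k)%:R^-1 - - k%:R^-1 = p%:R * - (k%:R^-1 * (k%:R - p%:R)^-1) :> rat.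
  rewrite natr_subp //; have := subp_neq0 hk; have /andP[/natr_neq0] := hk.
  by move: (k%:R) => K K0 _ KP; field; rewrite K0 KP.
by rewrite pdvd_mulr ?pdvd_p // rpredN rpredM ?pint_inv ?pint_subpV.
Qed.

Lemma harmonic_rev k a : (0 < a < 6)%N -> (k < p)%N ->
  harmonic (p.-1 - k) a + (-1) ^+ a * harmonic k a \in pdvd p 1.
Proof.
move=> ha; elim: k => [|k IH] kp; first by rewrite subn0 harmonic0 mulr0 addr0 H_p.
have := IH (ltnW kp).
rewrite [harmonic (p.-1 - k) a]harmonic_rec; last by lia.
rewrite (_ : (p.-1 - k).-1 = p.-1 - k.+1)%N; last by lia.
rewrite (_ : (p.-1 - k) = p - k.+1)%N; last by lia.
have hk : (0 < k.+1 < p)%N by [].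
move=> h; rewrite harmonicS.
have -> : harmonic (p.-1 - k.+1) a + (-1) ^+ a * (harmonic k a + (k.+1%:R ^+ a)^-1) =
  (harmonic (p.-1 - k.+1) a + ((p - k.+1)%:R ^+ a)^-1 + (-1) ^+ a * harmonic k a)
  - (((p - k.+1)%:R ^+ a)^-1 - (-1) ^+ a * (k.+1%:R ^+ a)^-1) by ring.
by rewrite rpredB // inv_rev.
Qed.

(** * Duality modulo powers of p *)

(** Equals prod_{j<=k} (1 - p/j), hence congruent to 1 modulo p for k < p. *)
Definition altcoef (k : nat) : rat := (-1) ^+ k * 'C(p.-1, k)%:R.

Lemma altcoefS k : (0 < k < p)%N -> altcoef k = altcoef k.-1 * (1 - p%:R / k%:R).
Proof.
case: k => // k; case/andP=> _ kp; rewrite /altcoef /= exprS.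
have e : k.+1%:R * 'C(p.-1, k.+1)%:R = (p%:R - k.+1%:R) * 'C(p.-1, k)%:R :> rat.
  rewrite -natrB ?(ltnW kp) // -!natrM mul_bin_left; congr (_ * _)%:R; lia.
have -> : 'C(p.-1, k.+1)%:R = (p%:R - k.+1%:R) * 'C(p.-1, k)%:R / k.+1%:R :> rat.
  by rewrite -e mulrC mulKf ?natr_neq0.
by field; rewrite nat1r natr_neq0.
Qed.

(** The symmetry of the binomial coefficients; p-1 is even. *)
Lemma altcoef_rev k : (0 < k < p)%N -> altcoef (p - k).-1 = altcoef k.
Proof.
case/andP=> k0 kp; rewrite /altcoef (_ : (p - k).-1 = p.-1 - k)%N; last by lia.
rewrite bin_sub; last by lia.
by rewrite -signr_odd oddB; [case: p p_odd => //= m /negPf->; rewrite signr_odd | lia].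
Qed.

Lemma altcoef_expand k : (k < p)%N -> altcoef k - (1 - p%:R * harmonic k 1) \in pdvd p 2.
Proof.
elim: k => [|k IH] kp.
  by rewrite /altcoef bin0 harmonic0 !mulr0 subr0 mulr1 subrr rpred0.
have hk : (0 < k.+1 < p)%N by [].
rewrite altcoefS // harmonicS /=.
have -> : altcoef k * (1 - p%:R / k.+1%:R) - (1 - p%:R * (harmonic k 1 + (k.+1%:R ^+ 1)^-1)) =
   (altcoef k - (1 - p%:R * harmonic k 1)) * (1 - p%:R / k.+1%:R)
   + p%:R ^+ 2 * (harmonic k 1 / k.+1%:R).
  by field; rewrite nat1r natr_neq0.
rewrite rpredD // pdvd_mulr ?pdvd_exp ?IH ?(ltnW kp) //.
  by rewrite rpredB ?rpred1 // rpredM ?rpred_nat ?pint_inv.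
by rewrite rpredM ?pint_harmonic ?pint_inv // ltnW.
Qed.

Lemma altcoef1 k : (k < p)%N -> altcoef k - 1 \in pdvd p 1.
Proof.
move=> kp; have -> : altcoef k - 1 = (altcoef k - (1 - p%:R * harmonic k 1)) - p%:R * harmonic k 1 by ring.
apply: rpredB; first by apply: pdvdW (altcoef_expand kp).
by rewrite pdvd_mulr ?pdvd_p ?pint_harmonic.
Qed.

(** The weights of the transform at n = p are p/k prod_{j<k} (1 - p/j). *)
Lemma altcoef_sum (f : nat -> rat) :
  \sum_(1 <= k < p) altcoef k.-1 * f k / k%:R = (altbin f p - f p) / p%:R.
Proof.
rewrite /altbin big_nat_recr //= binn -signr_odd.
have -> : odd p.-1 = false by case: p p_odd => //= m /negPf.
rewrite expr0 !mul1r addrK mulr_suml; apply: eq_big_nat => -[|k] // /andP[_ kp].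
rewrite /altcoef /=.
have e : p%:R * 'C(p.-1, k)%:R = k.+1%:R * 'C(p, k.+1)%:R :> rat.
  by rewrite -!natrM mul_bin_diag.
have -> : 'C(p.-1, k)%:R = k.+1%:R * 'C(p, k.+1)%:R / p%:R :> rat.
  by rewrite -e mulrC mulKf.
by field; rewrite nat1r pR0 pnatr_eq0.
Qed.

Let Hp a : harmonic p a = H a + (p%:R ^+ a)^-1.
Proof. exact: harmonic_rec. Qed.

Lemma altcoef_sum3 :
  \sum_(1 <= k < p) altcoef k.-1 / k%:R ^+ 3 = ((H 1 ^+ 2 + H 2) / 2 + H 1 / p%:R) / p%:R.
Proof.
have S11 : \sum_(1 <= j < p) harmonic j 1 / j%:R = (H 1 ^+ 2 + H 2) / 2.
  have := harmonicM p.-1 1 1; rewrite prednK // -expr2 => ->.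
  rewrite harmonicE // -!big_split mulr_suml; apply: eq_big_nat => k /andP[k0 _] /=.
  by rewrite (harmonic_rec _ k0) expr1; field; rewrite natr_neq0.
have := altcoef_sum (fun k => (k%:R ^+ 2)^-1).
rewrite altbin_inv_sqr big_nat_recr //= S11 Hp expr1 => e.
transitivity (((H 1 ^+ 2 + H 2) / 2 + (H 1 + p%:R^-1) / p%:R - (p%:R ^+ 2)^-1) / p%:R).
  rewrite -e; apply: eq_bigr => k _; rewrite -mulrA -invfM -exprSr //.
by field.
Qed.

Lemma altcoef_sum_harmonic2 :
  \sum_(1 <= k < p) altcoef k.-1 * harmonic k 2 / k%:R ^+ 2 =
  (\sum_(1 <= k < p) harmonic k 1 / k%:R ^+ 2 + H 1 / p%:R ^+ 2 - H 2 / p%:R) / p%:R.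
Proof.
have := altcoef_sum (fun k => harmonic k 2 / k%:R).
rewrite altbin_harmonic2_div big_nat_recr //= !Hp => e.
transitivity ((\sum_(1 <= k < p) harmonic k 1 / k%:R ^+ 2 + (H 1 + (p%:R ^+ 1)^-1) / p%:R ^+ 2
   - (H 2 + (p%:R ^+ 2)^-1) / p%:R) / p%:R).
  rewrite -e; apply: eq_bigr => k _; rewrite expr2 invfM; ring.
by field.
Qed.

(** By k -> p-k, the sum of altcoef (k-1) / k^2 equals that of
    altcoef (k-1) / (k (k-p)); the difference of the summands is p times the
    present one. *)
Lemma altcoef_sum_rev :
  \sum_(1 <= k < p) altcoef k.-1 * (k%:R ^+ 2)^-1 * (k%:R - p%:R)^-1 = 0.
Proof.
apply: (mulfI pR0); rewrite mulr0.
have /eqP : \sum_(1 <= k < p) altcoef k.-1 / (k%:R * (k%:R - p%:R)) =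
    \sum_(1 <= k < p) altcoef k.-1 / k%:R ^+ 2.
  rewrite [RHS]sum_rev; apply: eq_big_nat => k hk.
  rewrite altcoef_rev // (altcoefS hk) natr_subp //.
  have := subp_neq0 hk; have /andP[/natr_neq0] := hk.
  by move: (k%:R) => K K0 _ KP; field; rewrite K0 KP.
rewrite -subr_eq0 -sumrB => /eqP e; rewrite -[RHS]e mulr_sumr; apply: eq_big_nat => k hk.
have := subp_neq0 hk; have /andP[/natr_neq0] := hk.
by move: (k%:R) => K K0 _ KP; field; rewrite K0 KP.
Qed.

(** Two evaluations of the sum A3 of altcoef (k-1) / k^3: exactly by duality in
    terms of H(1) and H(2), and by the vanishing of altcoef_sum_rev expanded in
    powers of p/k, in terms of H(4) and H(1,4). Eliminating H(2) with
    harmonic1_harmonic2 also eliminates H(1), up to its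
    square, which is 0 modulo p^4. *)
Lemma harmonic4_double_sum :
  5 * H 4 - 4 * p%:R * \sum_(1 <= k < p) harmonic k.-1 1 / k%:R ^+ 4 \in pdvd p 2.
Proof.
pose H14 : rat := \sum_(1 <= k < p) harmonic k.-1 1 / k%:R ^+ 4; rewrite -/H14.
have kp1 k : (0 < k < p)%N -> (k.-1 < p)%N by lia.
pose A3 : rat := \sum_(1 <= k < p) altcoef k.-1 / k%:R ^+ 3.
pose A4 : rat := \sum_(1 <= k < p) altcoef k.-1 / k%:R ^+ 4.
pose A5 : rat := \sum_(1 <= k < p) altcoef k.-1 * ((k%:R ^+ 4)^-1 * (k%:R - p%:R)^-1).
have eA : A3 + p%:R * A4 + p%:R ^+ 2 * A5 = 0.
  rewrite -[RHS]altcoef_sum_rev !mulr_sumr -!big_split; apply: eq_big_nat => k hk /=.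
  have := subp_neq0 hk; have /andP[/natr_neq0] := hk.
  by move: (k%:R) => K K0 _ KP; field; rewrite K0 KP.
have hA4 : A4 - (H 4 - p%:R * H14) \in pdvd p 2.
  rewrite harmonicE // mulr_sumr -sumrB; apply: pdvd_sumB => k hk.
  have -> : altcoef k.-1 / k%:R ^+ 4 - ((k%:R ^+ 4)^-1 - p%:R * (harmonic k.-1 1 / k%:R ^+ 4)) =
    (altcoef k.-1 - (1 - p%:R * harmonic k.-1 1)) / k%:R ^+ 4 by ring.
  by rewrite pdvd_mulr ?pint_invX // altcoef_expand ?kp1.
have hA5 : A5 \in pdvd p 1.
  rewrite -[A5](subrK (H 5)) rpredD ?H_p // harmonicE //; apply: pdvd_sumB => k hk.
  have -> : altcoef k.-1 * ((k%:R ^+ 4)^-1 * (k%:R - p%:R)^-1) - (k%:R ^+ 5)^-1 =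
     (altcoef k.-1 - 1) * ((k%:R ^+ 4)^-1 * (k%:R - p%:R)^-1)
     + p%:R * ((k%:R ^+ 5)^-1 * (k%:R - p%:R)^-1).
    have := subp_neq0 hk; have /andP[/natr_neq0] := hk.
    by move: (k%:R) => K K0 _ KP; field; rewrite K0 KP.
  by rewrite rpredD // pdvd_mulr ?altcoef1 ?kp1 ?pdvd_p ?rpredM ?pint_invX ?pint_subpV.
have h1 := wolstenholme.
have h12 := harmonic1_harmonic2.
have hA3 : p%:R ^+ 2 * A3 = p%:R * (H 1 ^+ 2 + H 2) / 2 + H 1.
  by rewrite /A3 altcoef_sum3; field.
suff : p%:R ^+ 3 * (5 * H 4 - 4 * p%:R * H14) \in pdvd p 5 by rewrite (@pdvd_cancel _ 2 3).
have -> : p%:R ^+ 3 * (5 * H 4 - 4 * p%:R * H14) =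
   - 4 * (p%:R ^+ 2 * A3 - (p%:R * (H 1 ^+ 2 + H 2) / 2 + H 1))
   + 4 * p%:R ^+ 2 * (A3 + p%:R * A4 + p%:R ^+ 2 * A5)
   - 4 * (p%:R ^+ 3 * (A4 - (H 4 - p%:R * H14)))
   - 4 * (p%:R ^+ 4 * A5)
   - 2 * (p%:R ^+ 1 * (H 1 * H 1))
   - 2 * (2 * H 1 + p%:R * H 2 - p%:R ^+ 3 * H 4 / 2) by field.
rewrite hA3 subrr eA !mulr0 !add0r.
have n2 : 2 \in pint p by exact: rpred_nat.
have n4 : 4 \in pint p by exact: rpred_nat.
apply: rpredB; last exact: pdvd_mull.
apply: rpredB.
  apply: rpredB.
    by rewrite rpredN pdvd_mull // (@pdvd_cancel _ 2 3).
  by rewrite pdvd_mull // (@pdvd_cancel _ 1 4).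
by rewrite pdvd_mull // (@pdvd_cancel _ 4 1) // (@pdvdM _ 2 2).
Qed.

(** Modulo p, k -> p-k exchanges H_{k-1}(1) with H_k(1) and H_{k-1}(2) with
    -H_k(2). It reverses the sign of the triple sum up to the diagonal terms,
    which are the two double sums. *)
Lemma triple_sum_112 :
  2 * (\sum_(1 <= k < p) harmonic k.-1 1 * harmonic k 2 / k%:R ^+ 2)
  - \sum_(1 <= k < p) harmonic k.-1 1 / k%:R ^+ 4
  + \sum_(1 <= k < p) harmonic k.-1 2 / k%:R ^+ 3 \in pdvd p 1.
Proof.
pose Z : rat := \sum_(1 <= k < p) harmonic k.-1 1 * harmonic k 2 / k%:R ^+ 2.
pose Z' : rat := \sum_(1 <= k < p) harmonic k 1 * - harmonic k.-1 2 / k%:R ^+ 2.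
have hZ : Z - Z' \in pdvd p 1.
  rewrite /Z sum_rev; apply: pdvd_sumB => k hk.
  have k0 : (0 < k)%N by case/andP: hk.
  have kp : (k < p)%N by case/andP: hk.
  have kp1 : (k.-1 < p)%N by lia.
  have pk : (p - k < p)%N by lia.
  have hpk : (0 < p - k < p)%N by lia.
  apply: pdvd_mulB.
  - apply: pdvd_mulB.
    + have := @harmonic_rev k 1 isT kp.
      by rewrite expr1 mulN1r (_ : p.-1 - k = (p - k).-1)%N //; lia.
    + have := @harmonic_rev k.-1 2 isT kp1.
      by rewrite sqrrN expr1n mul1r (_ : p.-1 - k.-1 = p - k)%N ?opprK //; lia.
    + exact: pint_harmonic.
    + exact: pint_harmonic.
  - by have := inv_rev 2 hk; rewrite sqrrN expr1n mul1r.
  - by rewrite rpredM ?rpredN ?pint_harmonic.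
  - exact: pint_invX.
have -> : 2 * (\sum_(1 <= k < p) harmonic k.-1 1 * harmonic k 2 / k%:R ^+ 2)
  - \sum_(1 <= k < p) harmonic k.-1 1 / k%:R ^+ 4
  + \sum_(1 <= k < p) harmonic k.-1 2 / k%:R ^+ 3 = Z - Z'.
  rewrite mulr_natl mulr2n /Z /Z' -big_split -!sumrB -big_split.
  apply: eq_big_nat => k /andP[k0 _] /=; rewrite !(harmonic_rec _ k0).
  by field; rewrite natr_neq0.
by [].
Qed.

(** Here k -> p-k exchanges the two factors H_{k-1}(2) and H_k(2) with two sign
    changes and changes the sign of 1/k: the sum is its own opposite modulo p. *)
Lemma triple_sum_221 :
  \sum_(1 <= k < p) harmonic k.-1 2 * harmonic k 2 / k%:R \in pdvd p 1.
Proof.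
pose U : rat := \sum_(1 <= k < p) harmonic k.-1 2 * harmonic k 2 / k%:R; rewrite -/U.
pose U' : rat := \sum_(1 <= k < p) harmonic k 2 * harmonic k.-1 2 * - (k%:R^-1).
have hU : U - U' \in pdvd p 1.
  rewrite /U sum_rev; apply: pdvd_sumB => k hk.
  have kp : (k < p)%N by case/andP: hk.
  have kp1 : (k.-1 < p)%N by lia.
  have pk : (p - k < p)%N by lia.
  have hpk : (0 < p - k < p)%N by lia.
  have rev j : (j < p)%N -> harmonic (p.-1 - j) 2 + harmonic j 2 \in pdvd p 1.
    by move=> jp; have := @harmonic_rev j 2 isT jp; rewrite sqrrN expr1n mul1r.
  apply: pdvd_mulB.
  - rewrite -[X in _ - X]mulrNN; apply: pdvd_mulB; rewrite ?opprK.
    + by have := rev k kp; rewrite (_ : p.-1 - k = (p - k).-1)%N //; lia.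
    + by have := rev k.-1 kp1; rewrite (_ : p.-1 - k.-1 = p - k)%N //; lia.
    + by rewrite rpredN pint_harmonic.
    + exact: pint_harmonic.
  - by have := inv_rev 1 hk; rewrite !expr1 mulN1r.
  - by rewrite rpredM ?pint_harmonic.
  - exact: pint_inv.
have -> : U = 2^-1 * (U - U').
  have -> : U' = - U by rewrite -sumrN; apply: eq_bigr => k _; ring.
  by field.
by rewrite pdvd_mull ?intV.
Qed.

(** The dual of H_k(2)/k is the sum of H_j(1)/j^2. On the dual side the factor p
    in front means that altcoef is only expanded to first order. *)
Lemma star_sum12 :
  \sum_(1 <= k < p) harmonic k 1 / k%:R ^+ 2 + H 1 / p%:R ^+ 2 - H 2 / p%:R
  - p%:R * ((H 2 ^+ 2 + H 4) / 2)
  + p%:R ^+ 2 * (\sum_(1 <= k < p) harmonic k.-1 1 * harmonic k 2 / k%:R ^+ 2) \in pdvd p 3.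
Proof.
have S22 : (H 2 ^+ 2 + H 4) / 2 = \sum_(1 <= k < p) harmonic k 2 / k%:R ^+ 2.
  have := harmonicM p.-1 2 2; rewrite prednK // -expr2 => ->.
  rewrite harmonicE // -!big_split mulr_suml; apply: eq_big_nat => k /andP[k0 _] /=.
  by rewrite (harmonic_rec _ k0); field; rewrite natr_neq0.
have := altcoef_sum_harmonic2 => /(congr1 ( *%R p%:R)).
rewrite [X in _ = X -> _]mulrC divfK // => <-; rewrite S22.
set S := \sum_(1 <= k < p) altcoef k.-1 * _ / _.
set S' := \sum_(1 <= k < p) harmonic k 2 / _.
set Z := \sum_(1 <= k < p) harmonic k.-1 1 * _ / _.
have -> : p%:R * S - p%:R * S' + p%:R ^+ 2 * Z = p%:R ^+ 1 * (S - (S' - p%:R * Z)) by ring.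
rewrite (@pdvd_cancel _ 2 1) // mulr_sumr -sumrB; apply: pdvd_sumB => k hk.
have kp : (k < p)%N by case/andP: hk.
have -> : altcoef k.-1 * harmonic k 2 / k%:R ^+ 2 - (harmonic k 2 / k%:R ^+ 2 -
    p%:R * (harmonic k.-1 1 * harmonic k 2 / k%:R ^+ 2)) =
  (altcoef k.-1 - (1 - p%:R * harmonic k.-1 1)) * (harmonic k 2 / k%:R ^+ 2) by ring.
by rewrite pdvd_mulr ?pint_divX ?pint_harmonic // altcoef_expand //; lia.
Qed.

(** As p is odd, k -> p-k changes the sign of (-1)^(k-1), so the sums of weight four
    cancel up to p times one of weight five, whose even terms form a half sum. *)
Lemma alternating_sum4 :
  2 * (\sum_(1 <= k < p) (-1) ^+ k.-1 / k%:R ^+ 4) - p%:R / 4 * harmonic p./2 5 \in pdvd p 2.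
Proof.
pose A : rat := \sum_(1 <= k < p) (-1) ^+ k.-1 / k%:R ^+ 4; rewrite -/A.
pose A5 : rat := \sum_(1 <= k < p) (-1) ^+ k / k%:R ^+ 5.
have split m (f : nat -> rat) : \sum_(1 <= k < (2 * m).+1) (-1) ^+ k * f k =
   2 * (\sum_(1 <= k < m.+1) f (2 * k)%N) - \sum_(1 <= k < (2 * m).+1) f k.
  elim: m => [|m IH]; first by rewrite !big_geq // mulr0 subr0.
  rewrite [in RHS]big_nat_recr //= mulnS !add2n.
  have recr (F : nat -> rat) : \sum_(1 <= k < (2 * m).+3) F k =
    \sum_(1 <= k < (2 * m).+1) F k + F (2 * m).+1 + F (2 * m).+2.
    by rewrite 2?big_nat_recr.
  rewrite !recr IH !exprS exprM sqrrN !expr1n; ring.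
have eA5 : A5 = harmonic p./2 5 / 16 - H 5.
  have ep : p = (2 * p./2).+1 by rewrite -{1}(odd_double_half p) p_odd mul2n.
  rewrite /A5 {1}ep split -ep -harmonicE // /harmonic mulr_sumr mulr_suml.
  congr (_ - _); apply: eq_big_nat => k /andP[k0 _].
  by rewrite natrM; field; rewrite natr_neq0.
(* The polynomial is the rest of the series of (1 - p/k)^-4 after its linear term. *)
have eA : 2 * A - 4 * p%:R * A5 = \sum_(1 <= k < p) p%:R ^+ 2 * ((-1) ^+ k *
    ((10 * k%:R ^+ 3 - 20 * p%:R * k%:R ^+ 2 + 15 * p%:R ^+ 2 * k%:R - 4 * p%:R ^+ 3)
    * ((k%:R ^+ 5)^-1 * (k%:R - p%:R)^-1 ^+ 4))).
  rewrite mulr_natl mulr2n {1}/A sum_rev mulr_sumr -big_split -sumrB.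
  apply: eq_big_nat => k hk /=; rewrite natr_subp //.
  have -> : (-1) ^+ (p - k).-1 = (-1) ^+ k :> rat.
    rewrite -signr_odd -[RHS]signr_odd; congr (_ ^+ nat_of_bool _); lia.
  have -> : (-1) ^+ k.-1 = - (-1) ^+ k :> rat.
    by case: k hk => // k _; rewrite exprS mulN1r opprK.
  have := subp_neq0 hk; have /andP[/natr_neq0] := hk.
  by move: (k%:R) => K K0 _ KP; field; rewrite K0 KP.
have -> : 2 * A - p%:R / 4 * harmonic p./2 5 = (2 * A - 4 * p%:R * A5) - p%:R * (4 * H 5).
  by rewrite eA5; field.
have n m : m%:R \in pint p by exact: rpred_nat.
rewrite rpredB //; last by rewrite (@pdvdM _ 1 1) ?pdvd_p // pdvd_mull // H_p.
rewrite eA; apply: pdvd_sum => k hk; rewrite pdvd_mulr ?pdvd_exp //.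
apply: rpredM; first by rewrite rpredX // rpredN rpred1.
apply: rpredM; last by rewrite rpredM ?pint_invX ?rpredX ?pint_subpV.
by apply: rpredB; [apply: rpredD; [apply: rpredB|]|]; rewrite ?rpredM ?rpredX.
Qed.

(** * The tail and the resulting congruence *)

(** With w_k the inverse of prod_{j<=k} (1 - p^2/j^2), p times the summand is
    H_{k-1}(2) (p+k)/k^2 w_k, and w_k is 1 + p^2 H_k(2) to the precision used. *)
Lemma tail_term_expand :
  p%:R * (\sum_(1 <= k < p) harmonic k.-1 2 * tail_term p.-1 k)
  - (\sum_(1 <= k < p) harmonic k.-1 2 / k%:R
     + p%:R * (\sum_(1 <= k < p) harmonic k.-1 2 / k%:R ^+ 2)
     + p%:R ^+ 2 * (\sum_(1 <= k < p) harmonic k.-1 2 * harmonic k 2 / k%:R)) \in pdvd p 3.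
Proof.
pose w k : rat := p%:R * (-1) ^+ k / ((p%:R + k%:R) * 'C(p.-1, k)%:R * 'C(p.-1 + k, k)%:R).
have pk0 k : p%:R + k%:R != 0 :> rat by rewrite -natrD natr_neq0 // addn_gt0 p_gt0.
have wS k : (k.+1 < p)%N -> w k.+1 = w k * (k.+1%:R ^+ 2 / (k.+1%:R ^+ 2 - p%:R ^+ 2)).
  move=> kp; have hk : (0 < k.+1 < p)%N by [].
  have e1 : 'C(p.-1, k.+1)%:R = (p%:R - k.+1%:R) * 'C(p.-1, k)%:R / k.+1%:R :> rat.
    rewrite -natrB ?(ltnW kp) // -natrM (_ : p - k.+1 = p.-1 - k)%N; last by lia.
    by rewrite -mul_bin_left natrM mulrC mulKf ?natr_neq0.
  have e2 : 'C(p.-1 + k.+1, k.+1)%:R = (p%:R + k%:R) * 'C(p.-1 + k, k)%:R / k.+1%:R :> rat.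
    rewrite -natrD (_ : p + k = (p.-1 + k).+1)%N; last by lia.
    have /= e := mul_bin_diag (p.-1 + k).+1 k.
    by rewrite -natrM e addnS natrM mulrC mulKf ?natr_neq0.
  have b1 : 'C(p.-1, k)%:R != 0 :> rat by apply: bin_neq0; lia.
  have b2 : 'C(p.-1 + k, k)%:R != 0 :> rat by apply: bin_neq0; lia.
  have := subp_neq0 hk; have := pk0 k.+1; have := pk0 k.
  rewrite /w e1 e2 exprS; move: ('C(_, _)%:R) ('C(_, _)%:R) b1 b2 => C1 C2 b1 b2.
  have := natr_neq0 (ltn0Sn k); rewrite -nat1r; move: (k%:R) => K K0 pK pK1 pK1'.
  have pK2 : (1 + K) ^+ 2 - p%:R ^+ 2 != 0 by rewrite subr_sqr mulf_neq0 // addrC.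
  have pK3 : p%:R - (1 + K) != 0 by rewrite -opprB oppr_eq0.
  by field; rewrite b1 b2 K0 pK pK1 pK2 pK3.
have w0 : w 0%N = 1.
  rewrite /w !bin0 mulr0n expr0 addr0 !mulr1.
  exact: (mulfV pR0).
have hw k : (k < p)%N -> w k - (1 + p%:R ^+ 2 * harmonic k 2) \in pdvd p 3.
  elim: k => [|k IH] kp; first by rewrite w0 harmonic0 mulr0 addr0 subrr rpred0.
  have hk : (0 < k.+1 < p)%N by [].
  pose c : rat := (k.+1%:R - p%:R)^-1 * (k.+1%:R + p%:R)^-1.
  have intc : c \in pint p.
    rewrite rpredM ?pint_subpV // -natrD pint_natV //.
    by rewrite coprime_sym /coprime gcdnDr -/(coprime _ _) coprime_sym coprime_lt_prime.
  have -> : w k.+1 - (1 + p%:R ^+ 2 * harmonic k.+1 2) =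
    (w k - (1 + p%:R ^+ 2 * harmonic k 2)) * (1 + p%:R ^+ 2 * c)
    + p%:R ^+ 3 * (p%:R * (c * (harmonic k 2 + (k.+1%:R ^+ 2)^-1))).
    rewrite wS // harmonicS /c; have := subp_neq0 hk; have := pk0 k.+1.
    move: (w k) (harmonic k 2) => W h; have := natr_neq0 (ltn0Sn k).
    move: (k.+1%:R) => K K0; rewrite addrC => pK pK1.
    have pK2 : K ^+ 2 - p%:R ^+ 2 != 0 by rewrite subr_sqr mulf_neq0.
    by field; rewrite K0 pK pK1 pK2.
  have intp : p%:R \in pint p by exact: rpred_nat.
  apply: rpredD; last first.
    by rewrite pdvd_mulr ?pdvd_exp // rpredM // rpredM // rpredD ?pint_invX ?pint_harmonic // ltnW.
  by rewrite pdvd_mulr ?IH ?(ltnW kp) // rpredD ?rpred1 // rpredM ?rpredX.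
rewrite !mulr_sumr -!big_split -sumrB; apply: pdvd_sum => k hk /=.
have kp : (k < p)%N by case/andP: hk.
have kp1 : (k.-1 < p)%N by lia.
have -> : p%:R * (harmonic k.-1 2 * tail_term p.-1 k) =
    harmonic k.-1 2 * ((p%:R + k%:R) * (k%:R ^+ 2)^-1) * w k.
  have b1 : 'C(p.-1, k)%:R != 0 :> rat by apply: bin_neq0; lia.
  have b2 : 'C(p.-1 + k, k)%:R != 0 :> rat by apply: bin_neq0; lia.
  have k0 : k%:R != 0 :> rat by case/andP: hk => /natr_neq0.
  rewrite /w /tail_term (_ : (-1) ^+ (p.-1 + k) = (-1) ^+ k); last first.
    rewrite -signr_odd -[RHS]signr_odd; congr (_ ^+ nat_of_bool _); lia.
  by have pk0k := pk0 k; field; rewrite b1 b2 k0 pk0k.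
have -> : harmonic k.-1 2 * ((p%:R + k%:R) * (k%:R ^+ 2)^-1) * w k
   - (harmonic k.-1 2 / k%:R + p%:R * (harmonic k.-1 2 / k%:R ^+ 2)
      + p%:R ^+ 2 * (harmonic k.-1 2 * harmonic k 2 / k%:R)) =
   harmonic k.-1 2 * ((p%:R + k%:R) * (k%:R ^+ 2)^-1) * (w k - (1 + p%:R ^+ 2 * harmonic k 2))
   + p%:R ^+ 3 * (harmonic k.-1 2 * harmonic k 2 * (k%:R ^+ 2)^-1).
  by field; case/andP: hk => /natr_neq0.
apply: rpredD.
  apply: pdvd_mull; last exact: hw.
  by rewrite rpredM ?pint_harmonic // rpredM ?pint_invX // rpredD ?rpred_nat.
by rewrite pdvd_mulr ?pdvd_exp // rpredM ?pint_invX // rpredM ?pint_harmonic.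
Qed.

(** C(p-1,4) is 1 modulo p, as an instance of altcoef. *)
Lemma bin4_over_pred : 'C(p - 1, 4)%:R / (p - 1)%:R + 1 \in pdvd p 1.
Proof.
have p4 : (4 < p)%N by lia.
have hc := altcoef1 p4.
rewrite /altcoef -subn1 in hc.
have e : (p - 1)%:R = p%:R - 1 :> rat by rewrite natrB.
have p1 : (p - 1)%:R != 0 :> rat by apply: natr_neq0; lia.
have -> : 'C(p - 1, 4)%:R / (p - 1)%:R + 1 =
   ((-1) ^+ 4 * 'C(p - 1, 4)%:R - 1 + p%:R) * (p - 1)%:R^-1 :> rat.
  by move: p1; rewrite e => p1; field.
apply: pdvd_mulr; first by apply: rpredD; [exact: hc | exact: pdvd_p].
by apply: pint_inv => //; lia.
Qed.

(** C(p-2,3) = 4 C(p-1,4) / (p-1), and C(p-1,4) is 1 modulo p. *)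
Lemma bin3_over_pred : 'C(p - 2, 3)%:R / (p - 2)%:R - 2 \in pdvd p 1.
Proof.
have p4 : (4 < p)%N by lia.
have hc := altcoef1 p4.
rewrite /altcoef -subn1 in hc.
have e1 : (p - 1)%:R = p%:R - 1 :> rat by rewrite natrB.
have p1 : (p - 1)%:R != 0 :> rat by apply: natr_neq0; lia.
have e2 : (p - 2)%:R = p%:R - 2 :> rat by rewrite natrB //; lia.
have p2 : (p - 2)%:R != 0 :> rat by apply: natr_neq0; lia.
have -> : 'C(p - 2, 3)%:R = 4 * 'C(p - 1, 4)%:R / (p - 1)%:R :> rat.
  have := mul_bin_diag (p - 1) 3; rewrite (_ : (p - 1).-1 = p - 2)%N; last by lia.
  by rewrite -natrM => <-; rewrite natrM mulrC (mulKf p1).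
have -> : 4 * 'C(p - 1, 4)%:R / (p - 1)%:R / (p - 2)%:R - 2 =
   (4 * ((-1) ^+ 4 * 'C(p - 1, 4)%:R - 1) + p%:R * (6 - 2 * p%:R)) * ((p - 1)%:R^-1 * (p - 2)%:R^-1) :> rat.
  by move: p1 p2; rewrite e1 e2 => p1 p2; field; rewrite p1 p2.
have n m : m%:R \in pint p by exact: rpred_nat.
rewrite pdvd_mulr //.
  apply: rpredD; first exact: pdvd_mull.
  by rewrite pdvd_mulr ?pdvd_p // rpredB // rpredM.
by rewrite rpredM // pint_inv //; lia.
Qed.

(** The sums H(2,1) and H(2,2) of the tail are eliminated by products of harmonic
    numbers; the rest is a linear combination of the previous congruences. *)
Lemma leshchiner_pdvd :
  2 * (\sum_(1 <= k < p) (-1) ^+ k.-1 / k%:R ^+ 4)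
  + \sum_(1 <= k < p) harmonic k.-1 2 * tail_term p.-1 k
  - (3 / p%:R ^+ 3 * H 1 - 6 / 5 * p%:R * bernoulli (p - 5)) \in pdvd p 2.
Proof.
have p5 : (0 < p - 5 < p)%N by lia.
have p5' : ((p - 5).+1 < p)%N by lia.
have a5 : (1 < 5 < p.-1)%N by lia.
have le5 : (5 <= p)%N by lia.
have := tail_term_expand; have := alternating_sum4.
have := star_sum12; have := triple_sum_221.
have := triple_sum_112; have := harmonic4_double_sum.
pose A : rat := \sum_(1 <= k < p) (-1) ^+ k.-1 / k%:R ^+ 4; rewrite -/A.
pose R' : rat := \sum_(1 <= k < p) harmonic k.-1 2 * tail_term p.-1 k; rewrite -/R'.
pose H14 : rat := \sum_(1 <= k < p) harmonic k.-1 1 / k%:R ^+ 4; rewrite -/H14.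
pose H23 : rat := \sum_(1 <= k < p) harmonic k.-1 2 / k%:R ^+ 3; rewrite -/H23.
pose H21 : rat := \sum_(1 <= k < p) harmonic k.-1 2 / k%:R; rewrite -/H21.
pose H22 : rat := \sum_(1 <= k < p) harmonic k.-1 2 / k%:R ^+ 2; rewrite -/H22.
pose S12 : rat := \sum_(1 <= k < p) harmonic k 1 / k%:R ^+ 2; rewrite -/S12.
pose Z : rat := \sum_(1 <= k < p) harmonic k.-1 1 * harmonic k 2 / k%:R ^+ 2; rewrite -/Z.
pose U : rat := \sum_(1 <= k < p) harmonic k.-1 2 * harmonic k 2 / k%:R; rewrite -/U.
pose B := bernoulli (p - 5); rewrite -/B.
set h := harmonic p./2 5.
move=> x4 xZ xU xS xA xR.
have xH := harmonic1_harmonic2.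
have eH21 : H21 = H 1 * H 2 - S12.
  rewrite harmonicM prednK // -/S12 addrAC subrr add0r.
  by apply: eq_bigr => k _; rewrite expr1.
have eH22 : H22 = (H 2 ^+ 2 - H 4) / 2.
  have := harmonicM p.-1 2 2; rewrite prednK // -expr2 => ->.
  rewrite harmonicE // -big_split -sumrB mulr_suml; apply: eq_big_nat => k /andP[k0 _] /=.
  by rewrite (harmonic_rec _ k0); field; rewrite natr_neq0.
have intB : B \in pint p by exact: bernoulli_pint.
have n m : m%:R \in pint p by exact: rpred_nat.
have y14 : H14 - B \in pdvd p 1.
  have := @double_harmonic_pdvd p p_prime 1 4 isT isT (leq_trans _ p_gt6).
  rewrite -/H14 -/B => /(_ isT) d.
  have -> : H14 - B = (H14 + 'C(p - 1, 4)%:R / (p - 1)%:R * B)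
     - ('C(p - 1, 4)%:R / (p - 1)%:R + 1) * B by ring.
  by apply: rpredB => //; rewrite pdvd_mulr // bin4_over_pred.
have y23 : H23 + 2 * B \in pdvd p 1.
  have := @double_harmonic_pdvd p p_prime 2 3 isT isT (leq_trans _ p_gt6).
  rewrite -/H23 -/B => /(_ isT) d.
  have -> : H23 + 2 * B = (H23 + 'C(p - 2, 3)%:R / (p - 2)%:R * B)
     - ('C(p - 2, 3)%:R / (p - 2)%:R - 2) * B by ring.
  by apply: rpredB => //; rewrite pdvd_mulr // bin3_over_pred.
have yh : h + 6 * B \in pdvd p 1.
  have p50 : (p - 5)%:R != 0 :> rat by apply: natr_neq0; case/andP: p5.
  have e5 : (p - 5)%:R = p%:R - 5 :> rat by rewrite natrB.
  have := half_harmonic_pdvd p_prime p_odd a5; rewrite -/h -/B => d.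
  have -> : h + 6 * B = (h - (2 ^+ 5 - 2) / (p - 5)%:R * B)
     + p%:R * (6 * (p - 5)%:R^-1 * B).
    by move: p50; rewrite e5 => p50; field.
  by rewrite rpredD // pdvd_mulr ?pdvd_p // rpredM // rpredM // pint_inv.
have x1x2 : H 1 * H 2 \in pdvd p 3.
  by apply: (@pdvdM _ 2 1); [exact: wolstenholme | exact: H_p].
(* The facts above determine these sums; they are atoms for the final identity. *)
clearbody A R' H14 H23 H21 H22 S12 Z U B h.
rewrite -(@pdvd_cancel p 2 1) // expr1.
have -> : p%:R * (2 * A + R' - (3 / p%:R ^+ 3 * H 1 - 6 / 5 * p%:R * B)) =
    (p%:R * R' - (H21 + p%:R * H22 + p%:R ^+ 2 * U))
  + p%:R ^+ 2 * U
  + p%:R ^+ 1 * (2 * A - p%:R / 4 * h)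
  + p%:R ^+ 2 * (4^-1 * (h + 6 * B))
  + H 1 * H 2
  - (S12 + H 1 / p%:R ^+ 2 - H 2 / p%:R - p%:R * ((H 2 ^+ 2 + H 4) / 2) + p%:R ^+ 2 * Z)
  - (2 * H 1 + p%:R * H 2 - p%:R ^+ 3 * H 4 / 2) / p%:R ^+ 2
  - p%:R ^+ 1 * (3%:R / 10 * (5 * H 4 - 4 * p%:R * H14))
  + p%:R ^+ 2 * (2^-1 * (2 * Z - H14 + H23))
  - p%:R ^+ 2 * (7 / 10 * (H14 - B))
  - p%:R ^+ 2 * (2^-1 * (H23 + 2 * B)).
  rewrite eH21 eH22; move: (H 1) (H 2) (H 4) => H1 H2 H4; move: p%:R pR0 => P P0.
  by field.
have i10 : 10^-1 \in pint p.
  have -> : 10^-1 = 2^-1 * 5^-1 :> rat by field.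
  by rewrite rpredM ?intV.
apply: rpredB; last by rewrite (@pdvd_cancel _ 1 2) // pdvd_mull ?intV.
apply: rpredB; last by rewrite (@pdvd_cancel _ 1 2) // pdvd_mull // rpredM.
apply: rpredD; last by rewrite (@pdvd_cancel _ 1 2) // pdvd_mull ?intV.
apply: rpredB; last by rewrite (@pdvd_cancel _ 2 1) // pdvd_mull // rpredM.
apply: rpredB; last exact: pdvd_div.
apply: rpredB => //; apply: rpredD => //.
apply: rpredD; last by rewrite (@pdvd_cancel _ 1 2) // pdvd_mull ?intV.
apply: rpredD; last by rewrite (@pdvd_cancel _ 2 1).
by apply: rpredD => //; rewrite (@pdvd_cancel _ 1 2).
Qed.

End ModPrimePower.

(** * The prime 5, and the theorem *)

Lemma leshchiner_five :
  4 * (\sum_(1 <= k < 5) (k%:R ^+ 4 * 'C(2 * k, k)%:R)^-1)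
  - 3 * (\sum_(1 <= k < 5) harmonic k.-1 2 / (k%:R ^+ 2 * 'C(2 * k, k)%:R))
  - (3 / 5%:R ^+ 3 * harmonic 4 1 - 6 / 5 * 5%:R * bernoulli 0) \in pdvd 5 2.
Proof.
(* The difference of the two sides is 25 * 11387 / 36288. *)
apply: (@pdvdI _ _ _ (59 * 193 * (2^-1 ^+ 6 * 3^-1 ^+ 4 * 7^-1))); first by [].
  have n m : m%:R \in pint 5 by exact: rpred_nat.
  apply: rpredM; first by apply: rpredM; exact: n.
  by apply: rpredM; [apply: rpredM; apply: rpredX|]; exact: pint_natV.
have [c1 c2 c3 c4] : [/\ 'C(2 * 1, 1) = 2%N, 'C(2 * 2, 2) = 6%N, 'C(2 * 3, 3) = 20%N & 'C(2 * 4, 4) = 70%N] by [].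
have range (F : nat -> rat) : \sum_(1 <= k < 5) F k = F 1%N + F 2%N + F 3%N + F 4%N.
  by rewrite /index_iota /= !big_cons big_nil addr0 !addrA.
rewrite !range c1 c2 c3 c4 /= bernoulli0 !harmonicS !harmonic0.
by field.
Qed.
Unset Implicit Arguments.

Theorem theorem1 (p : nat) (p_prime : prime p) (p_gt3 : (3 < p)%N) :
  rat_eqmod p 2
    (4 * (\sum_(1 <= k < p) (k%:R ^+ 4 * 'C(2 * k, k)%:R)^-1)
     - 3 * (\sum_(1 <= k < p) harmonic k.-1 2 / (k%:R ^+ 2 * 'C(2 * k, k)%:R)))
    (3 / p%:R ^+ 3 * harmonic p.-1 1 - 6 / 5 * p%:R * bernoulli (p - 5)).
Proof.
apply: pdvd_rat_eqmod => //.
have [->|p5] := eqVneq p 5; first exact: leshchiner_five.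
have p_gt6 : (6 < p)%N.
  by case: p p_prime p_gt3 p5 => [|[|[|[|[|[|[|p]]]]]]].
have := leshchiner_finite p.-1; rewrite prednK ?prime_gt0 // => ->.
exact: leshchiner_pdvd.
Qed.
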